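(* Let $\mu>1$, $0<\epsilon<\frac{\mu^2}{4}$ and $0\le\eta\le\frac{\mu^2}{4}$, and set $$\alpha:=\frac{\mu+\sqrt{\mu^2-4\eta}}{2},\qquad\beta:=\frac{\mu+\sqrt{\mu^2-4\epsilon}}{2}=\mu-b .$$ Then for all $f\in\mathcal D_\mu$, $$\int_0^\infty|f''|^2x^{\mu+1}dx-\eta\int_0^\infty|f'|^2x^{\mu-1}dx+\int_0^\infty\big(x^2|f'|^2-\epsilon|f|^2\big)x^{\mu-1}dx$$ $$\ge\ \Big(1+\mu+\sqrt{\mu^2-4\epsilon}-\sqrt{\mu^2-4\eta}\Big)\int_0^\infty|f'|^2x^{\mu}dx-\frac{\mu+\sqrt{\mu^2-4\epsilon}}{2}\,\frac{\mu-\sqrt{\mu^2-4\eta}}{2}\,(\mu-1)\int_0^\infty|f|^2x^{\mu-2}dx ,$$ with equality if and only if $f=C\,e^{-x}{}_1F_1(\alpha-\beta,\alpha,x)$ for some constant $C$. More precisely, one has the identity $$\int_0^\infty\Big|xf''+(\alpha+x)f'+\beta f\Big|^2x^{\mu-1}dx=Q[f]-\eta J[f]+P_1[f]-\Big(1+\mu+\sqrt{\mu^2-4\epsilon}-\sqrt{\mu^2-4\eta}\Big)P_0[f]+\beta(\mu-1)(\mu-\alpha)M_-[f].$$ For $\eta=0$ one has $\alpha=\mu$, the last term vanishes, and the identity becomes $$Q[f]+P_1[f]-\Big(1+\sqrt{\mu^2-4\epsilon}\Big)P_0[f]=\int_0^\infty\Big|xf''+(x+\mu)f'+(\mu-b)f\Big|^2x^{\mu-1}dx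 ,$$ which holds for all $\mu>0$ (with $0<\epsilon<\mu^2/4$, $f\in\mathcal D_\mu$); it contains the inequality $Q[f]+P_1[f]\ge(1+\sqrt{\mu^2-4\epsilon})P_0[f]$ with its equality case $f=Cf_0$.
   Context: Functions are real-valued. ${}_1F_1$ is Kummer's confluent hypergeometric function. Notation: $$Q[f]:=\int_0^\infty|f''|^2x^{\mu+1}dx,\quad P_1[f]:=\int_0^\infty\big(x^2|f'|^2-\epsilon|f|^2\big)x^{\mu-1}dx,\quad P_0[f]:=\int_0^\infty|f'|^2x^{\mu}dx,$$ $$J[f]:=\int_0^\infty|f'|^2x^{\mu-1}dx,\qquad M_-[f]:=\int_0^\infty|f|^2x^{\mu-2}dx,$$ $$b:=\frac{\mu-\sqrt{\mu^2-4\epsilon}}{2},\qquad f_0(x):=e^{-x}{}_1F_1(b,\mu,x)={}_1F_1(\mu-b,\mu,-x).$$ The space $\mathcal D_\mu$ is the completion of $C_c^\infty([0,\infty))$ (smooth functions with compact support in $[0,\infty)$, not required to vanish at $0$) with respect to the norm $$\|f\|_{\mathcal D_\mu}^2:=\int_0^\infty|f''|^2x^{\mu+1}dx+\int_0^\infty|f'|^2x^{\mu+1}dx+\int_0^\infty|f'|^2x^{\mu-1}dx+\int_0^\infty|f|^2x^{\mu-1}dx .$$ *)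

(* Defs.v *)
From HB Require Import structures.
From mathcomp Require Import all_boot all_order all_algebra.
From mathcomp Require Import all_classical all_reals all_analysis.
Set Implicit Arguments.
Unset Strict Implicit.
Unset Printing Implicit Defensive.
Import Order.TTheory GRing.Theory Num.Theory.
Import numFieldNormedType.Exports.
Local Open Scope classical_set_scope.
Local Open Scope ring_scope.

(* Elements of the function spaces are functions R -> R of which only the
   values on ]0, +oo[, up to Lebesgue-null sets, matter. *)
Definition half_line (R : realType) : set R := `]0, +oo[.

Definition integ (R : realType) (g : R -> R) : R :=
  \int[@lebesgue_measure R]_(x in @half_line R) g x.

(* [integ g] is the genuine value of the integral only when [integrable_hl g]. *)
Definition integrable_hl (R : realType) (g : R -> R) : Prop :=
  (@lebesgue_measure R).-integrable (@half_line R) (EFin \o g).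

Definition smooth (R : realType) (phi : R -> R) : Prop :=
  forall (n : nat) (x : R), derivable (derive1n n phi) x 1.

(* C_c^oo([0, oo)), as the restrictions to [0, oo) of C_c^oo(R): there is no
   condition at 0. *)
Definition Cc_closed (R : realType) (phi : R -> R) : Prop :=
  smooth phi /\ exists M : R, forall x : R, M < `|x| -> phi x = 0.

(* C_c^oo((0, oo)) *)
Definition Cc_open (R : realType) (psi : R -> R) : Prop :=
  smooth psi /\
  exists a b : R, [/\ 0 < a, a < b &
    forall x : R, x \notin `[a, b] -> psi x = 0].

(* g is the weak derivative of f on (0, oo) *)
Definition is_wderiv (R : realType) (f g : R -> R) : Prop :=
  [/\ forall a b : R, 0 < a -> a < b ->
        (@lebesgue_measure R).-integrable `[a, b] (EFin \o f),
      forall a b : R, 0 < a -> a < b ->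
        (@lebesgue_measure R).-integrable `[a, b] (EFin \o g) &
      forall psi : R -> R, Cc_open psi ->
        integ (fun x => f x * derive1 psi x) = - integ (fun x => g x * psi x)].

Definition weakly_derivable (R : realType) (f : R -> R) : Prop :=
  exists g : R -> R, is_wderiv f g.

(* A representative of the weak derivative, which is unique up to a.e.
   equality; meaningful only when [weakly_derivable f]. *)
Definition wderiv (R : realType) (f : R -> R) : R -> R :=
  xget (fun _ : R => 0) [set g | is_wderiv f g].

(* The squared norm of D_mu, of a function with first and second derivatives
   f1 and f2. *)
Definition sqnormD (R : realType) (mu : R) (f f1 f2 : R -> R) : \bar R :=
  (\int[@lebesgue_measure R]_(x in @half_line R)
      (`|f2 x| ^+ 2 * x `^ (mu + 1))%:E +
   \int[@lebesgue_measure R]_(x in @half_line R)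
      (`|f1 x| ^+ 2 * x `^ (mu + 1))%:E +
   \int[@lebesgue_measure R]_(x in @half_line R)
      (`|f1 x| ^+ 2 * x `^ (mu - 1))%:E +
   \int[@lebesgue_measure R]_(x in @half_line R)
      (`|f x| ^+ 2 * x `^ (mu - 1))%:E)%E.

(* The completion D_mu realized as a function space. The abstract completion
   is the closure of the triples (phi, phi', phi'') in a product of weighted
   L^2 spaces; in a limit (f, f1, f2), f1 and f2 are the weak derivatives of f
   and f1, so the limit is determined by f. *)
Definition in_D (R : realType) (mu : R) (f : R -> R) : Prop :=
  [/\ weakly_derivable f, weakly_derivable (wderiv f) &
    exists phi : nat -> R -> R,
      (forall n, Cc_closed (phi n)) /\
      (fun n => sqnormD mu (fun x => f x - phi n x)
                  (fun x => wderiv f x - derive1 (phi n) x)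
                  (fun x => wderiv (wderiv f) x - derive1n 2 (phi n) x))
        @ \oo --> 0%E].

Section Functionals.
Context (R : realType) (mu : R).
Implicit Type f : R -> R.

Definition Q_dens f (x : R) : R :=
  `|wderiv (wderiv f) x| ^+ 2 * x `^ (mu + 1).
Definition P1_dens (eps : R) f (x : R) : R :=
  (x ^+ 2 * `|wderiv f x| ^+ 2 - eps * `|f x| ^+ 2) * x `^ (mu - 1).
Definition P0_dens f (x : R) : R := `|wderiv f x| ^+ 2 * x `^ mu.
Definition J_dens f (x : R) : R := `|wderiv f x| ^+ 2 * x `^ (mu - 1).
Definition Mminus_dens f (x : R) : R := `|f x| ^+ 2 * x `^ (mu - 2).

Definition Q f : R := integ (Q_dens f).
Definition P1 (eps : R) f : R := integ (P1_dens eps f).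
Definition P0 f : R := integ (P0_dens f).
Definition J f : R := integ (J_dens f).
Definition Mminus f : R := integ (Mminus_dens f).

(* |x f'' + (alpha + x) f' + beta f|^2 x^(mu - 1) *)
Definition square_dens (alpha beta : R) f (x : R) : R :=
  `|x * wderiv (wderiv f) x + (alpha + x) * wderiv f x + beta * f x| ^+ 2
    * x `^ (mu - 1).

End Functionals.

Definition poch (R : realType) (a : R) (n : nat) : R :=
  \prod_(i < n) (a + i%:R).

(* Kummer's 1F1(a, c, x) *)
Definition kummer (R : realType) (a c x : R) : R :=
  limn (series (fun n => poch a n / poch c n * (x ^+ n / n`!%:R))).

Definition ae_eq_half_line (R : realType) (f g : R -> R) : Prop :=
  {ae @lebesgue_measure R, forall x, @half_line R x -> f x = g x}.

(* Main.v *)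
(* For [f] in [C_c^oo([0, oo))], [|x f'' + (al + x) f' + be f|^2 x^(mu - 1)] minus
   the density of the right-hand side is the derivative of
   [(al + x) f'^2 x^mu + 2 be f f' x^mu + be (al - mu) f^2 x^(mu - 1) + be f^2 x^mu],
   which vanishes at [0] and at infinity. Each term of the identity is continuous
   for the norm of [D_mu]; for the term in [x^(mu - 2)] this is the Hardy-type
   inequality [(mu - 1) M_-[f] <= J[f] + int f^2 x^(mu - 1)].
   Equality holds iff [f] solves [x f'' + (al + x) f' + be f = 0] weakly. The
   du Bois-Reymond argument at Lebesgue points makes [f] a classical solution on
   [(0, oo)]; its Wronskian with [e^-x 1F1(al - be, al, x)] is [c x^-al e^-x], and
   [2 al >= mu] with the weighted integrability of [f] and [f'] at [0] forces
   [c = 0], hence proportionality by uniqueness for the Cauchy problem. *)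
Require Import Defs.
From HB Require Import structures.
From mathcomp Require Import all_boot all_order all_algebra.
From mathcomp Require Import all_classical all_reals all_analysis.
From mathcomp Require Import measurable_realfun ring lra.
Set Implicit Arguments.
Unset Strict Implicit.
Unset Printing Implicit Defensive.
Import Order.TTheory GRing.Theory Num.Theory.
Import numFieldNormedType.Exports.
Local Open Scope ring_scope.

(** One identity serves both halves of the theorem. When [mu <= 1] the integral M_- may diverge,
    while for [al = mu] its coefficient [be (mu - 1) (mu - al)] vanishes; hence the alternative
    [al = mu \/ 1 < mu], carried along up to the limit. The numbers [al] and [be] are roots of
    [X^2 - mu X + eta] and [X^2 - mu X + eps], which turns the coefficients [al^2 - al mu] and
    [be^2 - be mu] of the expanded square into [- eta] and [- eps]. That [al] is the larger root
    gives [2 al >= mu]: the derivative of a second solution grows like [x^-al] at [0], and its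
    square is then not integrable for the weight [x^(mu - 1)]. For [eta = mu^2 / 4] one has
    [2 al = mu], and the divergence is only logarithmic. An element of D_mu is known only almost
    everywhere and [wderiv] picks an arbitrary representative, so pointwise statements have to be
    recovered through continuous representatives, by means of test functions built from [exp(-1/x)].
    A value of [integ] is meaningful only for an integrable function, so convergence is established
    together with each limit. *)

(** * Rules for classical derivatives *)

Section DerivativeRules.
Variable R : realType.
Implicit Types (f g : R -> R) (x a b : R).

(* Unlike [is_derive], not a class: the derivative rules are then applied
   syntactically, with no interference from instance resolution. *)
Definition has_deriv f x a : Prop := is_derive x (1 : R) f a.

Lemma has_deriv_eq f x a b : has_deriv f x a -> a = b -> has_deriv f x b.
Proof. by move=> H <-. Qed.

Lemma has_derivD f g x a b : has_deriv f x a -> has_deriv g x b ->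
  has_deriv (fun y => f y + g y) x (a + b).
Proof. exact: is_deriveD. Qed.

Lemma has_derivN f x a : has_deriv f x a -> has_deriv (fun y => - f y) x (- a).
Proof. exact: is_deriveN. Qed.

Lemma has_derivB f g x a b : has_deriv f x a -> has_deriv g x b ->
  has_deriv (fun y => f y - g y) x (a - b).
Proof. exact: is_deriveB. Qed.

Lemma has_derivM f g x a b : has_deriv f x a -> has_deriv g x b ->
  has_deriv (fun y => f y * g y) x (a * g x + f x * b).
Proof.
move=> df dg; apply: has_deriv_eq (is_deriveM df dg) _.
by rewrite /GRing.scale /= addrC (mulrC a).
Qed.

Lemma has_derivX f n x a : has_deriv f x a ->
  has_deriv (fun y => f y ^+ n) x (n%:R * f x ^+ n.-1 * a).
Proof.
move=> df; have := is_deriveX n df.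
rewrite (_ : f ^+ n = fun y => f y ^+ n); last by rewrite exprfctE.
by move=> H; exact: has_deriv_eq H _.
Qed.

Lemma has_derivV f x a : f x != 0 -> has_deriv f x a ->
  has_deriv (fun y => (f y)^-1) x (- a / f x ^+ 2).
Proof.
move=> f0 df; apply: has_deriv_eq (is_deriveV f0 df) _.
by rewrite /GRing.scale /= !mulNr mulrC.
Qed.

Lemma has_deriv_comp f g x a b :
  has_deriv f (g x) a -> has_deriv g x b ->
  has_deriv (fun y => f (g y)) x (a * b).
Proof. exact: is_derive1_comp. Qed.

Lemma has_deriv_cst (c x : R) : has_deriv (fun _ : R => c) x 0.
Proof. exact: is_derive_cst. Qed.

Lemma has_deriv_id x : has_deriv (fun y : R => y) x 1.
Proof. exact: is_derive_id. Qed.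

Lemma has_deriv_expR f x a : has_deriv f x a ->
  has_deriv (fun y => expR (f y)) x (expR (f x) * a).
Proof. by move=> df; apply: has_deriv_comp df; exact: is_derive_expR. Qed.

Lemma has_deriv_near f g x a : (\forall y \near x, f y = g y) ->
  has_deriv f x a -> has_deriv g x a.
Proof. exact: near_eq_is_derive. Qed.

Lemma has_deriv_unique f x a b : has_deriv f x a -> has_deriv f x b -> a = b.
Proof. by move=> [_ <-] [_ <-]. Qed.

Lemma has_deriv_continuous f x a : has_deriv f x a -> {for x, continuous f}.
Proof.
by case=> df _; apply: differentiable_continuous; exact/derivable1_diffP.
Qed.

Lemma has_deriv_powR p x : 0 < x ->
  has_deriv (fun y => y `^ p) x (p * x `^ (p - 1)).
Proof. by move=> x0; exact: is_derive1_powR. Qed.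

End DerivativeRules.

Ltac deriv_step :=
  first [ eassumption
        | apply: has_deriv_expR
        | apply: has_deriv_powR
        | apply: has_deriv_cst | apply: has_deriv_id
        | apply: has_derivN | apply: has_derivB | apply: has_derivD
        | apply: has_derivM | apply: has_derivX | apply: has_derivV ].
Ltac deriv_tac := apply: has_deriv_eq; [by repeat deriv_step | rewrite /=].

(** * Smooth functions and a smooth step *)

Section SmoothFunctions.
Local Open Scope classical_set_scope.
Variable R : realType.
Implicit Types (f g : R -> R) (x : R).

Lemma has_deriv_derive1 f g :
  (forall x, has_deriv f x (g x)) -> derive1 f = g.
Proof. by move=> H; apply/funext => x; rewrite derive1E; case: (H x). Qed.

(** All iterated derivatives of a member stay in a class closed under differentiation, so a single
    differentiation step replaces a formula for the [n]-th derivative. *)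
Lemma smooth_coind (S : set (R -> R)) :
  (forall f, S f -> exists2 f', S f' & forall x, has_deriv f x (f' x)) ->
  forall f, S f -> smooth f.
Proof.
move=> HS f Sf n.
have Sn : S (derive1n n f).
  elim: n => [//|n /HS[f' Sf' /has_deriv_derive1 df]].
  by rewrite derive1nS /= df.
by move=> x; have [f' _ /(_ x) []] := HS _ Sn.
Qed.

Lemma smooth_has_deriv f : smooth f -> forall x, has_deriv f x (derive1 f x).
Proof.
by move=> /(_ 0%N) /= H x; rewrite derive1E; apply: derivableP; exact: H.
Qed.

Lemma smooth_derive1 f : smooth f -> smooth (derive1 f).
Proof. by move=> H n x; have := H n.+1 x; rewrite derive1Sn. Qed.

(** The whole family is introduced because differentiating [x^-n exp(-1/x)] raises the power of
    [1/x]; [step] is built from [flat 0]. *)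
Definition flat (n : nat) (x : R) : R :=
  if 0 < x then x ^- n * expR (- x^-1) else 0.

(* A class containing [flat n] and stable under differentiation, to which
   [smooth_coind] applies. *)
Inductive smooth_alg : (R -> R) -> Prop :=
| smooth_alg_smooth f : smooth f -> smooth_alg f
| smooth_alg_cst c : smooth_alg (fun=> c)
| smooth_alg_flat n : smooth_alg (flat n)
| smooth_algD f g :
    smooth_alg f -> smooth_alg g -> smooth_alg (fun x => f x + g x)
| smooth_algM f g :
    smooth_alg f -> smooth_alg g -> smooth_alg (fun x => f x * g x)
| smooth_algV f :
    (forall x, f x != 0) -> smooth_alg f -> smooth_alg (fun x => (f x)^-1)
| smooth_alg_affine f a c :
    smooth_alg f -> smooth_alg (fun x => f (a * x + c)).

(** The bound forces [f 0 = 0], and the difference quotient at [0] is then at most [K |h|]. *)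
Lemma has_deriv0_quadratic f (K : R) : (forall h, `|f h| <= K * h ^+ 2) ->
  has_deriv f 0 0.
Proof.
move=> fK.
have f0 : f 0 = 0.
  by apply/eqP; rewrite -normr_le0 (le_trans (fK 0))// expr0n mulr0.
have K0 : 0 <= K by have := fK 1; rewrite expr1n mulr1; apply: le_trans.
have H : h^-1 *: (f (h *: (1:R) + 0) - f 0) @[h --> (0:R)^'] --> (0:R).
  apply/cvgr0Pnorm_le => e e0; near=> h.
  have h0 : h != 0 by near: h; exact: nbhs_dnbhs_neq.
  rewrite f0 subr0 addr0 [h *: _]mulr1 [_ *: _]/(_ * _) normrM normfV.
  rewrite ler_pdivrMl ?normr_gt0// (le_trans (fK h))//.
  rewrite -[h ^+ 2]real_normK ?num_real// expr2 mulrA mulrC ler_pM2l ?normr_gt0//.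
  (* [K + 1] instead of [K], which may be [0]. *)
  have : `|h| < e / (K + 1).
    near: h; apply: dnbhs0_lt; rewrite divr_gt0// ltr_pwDr//.
  rewrite ltr_pdivlMr ?ltr_pwDr// => /ltW; apply: le_trans.
  by rewrite mulrDr mulr1 mulrC lerDl.
split; first by apply/cvg_ex; exists 0; exact: H.
by apply/cvg_lim => //; exact: H.
Unshelve. all: by end_near. Qed.

(** At [1/h] the exponential dominates its term of degree [n + 2]; against [h^-n] this leaves a
    factor [h^2]. *)
Lemma flat_quadratic n h : `|flat n h| <= n.+2`!%:R * h ^+ 2.
Proof.
rewrite /flat; case: ifPn => [h0|_]; last first.
  by rewrite normr0 mulr_ge0// sqr_ge0.
have y0 : 0 <= h^-1 by rewrite invr_ge0 ltW.
rewrite normrM (ger0_norm (expR_ge0 _)) ger0_norm ?invr_ge0 ?exprn_ge0 ?(ltW h0)//.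
have := expR_ge1Dxn n.+1 y0.
rewrite expRN => E.
have E1 : h^-1 ^+ n.+2 / n.+2`!%:R <= expR h^-1.
  by apply: le_trans E; rewrite lerDr.
rewrite ler_pdivrMr ?expR_gt0//.
rewrite ler_pdivrMr ?ltr0n ?fact_gt0// in E1.
have -> : h ^- n = h^-1 ^+ n.+2 * h ^+ 2.
  have hn : h != 0 by rewrite gt_eqF.
  by rewrite -exprVn -[n.+2]addn2 exprD -mulrA -exprMn mulVf// expr1n mulr1.
apply: le_trans (ler_wpM2r (sqr_ge0 h) E1) _.
by rewrite mulrAC mulrC mulrA mulrAC mulrA.
Qed.

Lemma has_deriv_flat n x :
  has_deriv (flat n) x (flat n.+2 x + - n%:R * flat n.+1 x).
Proof.
have [x0|x0|->] := ltgtP x 0.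
- rewrite /flat !ltNge !(ltW x0)/= mulr0 addr0.
  apply: (has_deriv_near _ (has_deriv_cst 0 x)).
  near=> y; rewrite ifF//; apply/negbTE; rewrite -leNgt ltW//.
  by near: y; exact: lt_nbhsl.
- rewrite /flat x0.
  apply: (@has_deriv_near _ (fun y => y ^- n * expR (- y^-1))).
    near=> y; rewrite ifT//; near: y; exact: lt_nbhsr.
  have xn : x != 0 by rewrite gt_eqF.
  have xn' : x ^+ n != 0 by rewrite expf_neq0.
  deriv_tac.
  (* [has_derivX] produces the exponent [n.-1], hence the separate case [n = 0]. *)
  case: n xn' => [|n] xn'; last by rewrite /= !exprS; field; rewrite ?expf_neq0 ?xn.
  by rewrite /= expr0; field.
(* At the junction the claimed derivative is [0], which the quadratic bound provides. *)
- rewrite {2 3}/flat ltxx mulr0 addr0.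
  exact: has_deriv0_quadratic (flat_quadratic n).
Unshelve. all: by end_near. Qed.

Lemma smooth_alg_has_deriv f : smooth_alg f ->
  exists2 f', smooth_alg f' & forall x, has_deriv f x (f' x).
Proof.
elim=> {f} [f sf|c|n|f g sf [f' sf' df] sg [g' sg' dg]
  |f g sf [f' sf' df] sg [g' sg' dg]|f f0 sf [f' sf' df]|f a c sf [f' sf' df]].
- by exists (derive1 f); [exact/smooth_alg_smooth/smooth_derive1|
    exact: smooth_has_deriv].
- by exists (fun=> 0); [exact: smooth_alg_cst|move=> x; exact: has_deriv_cst].
- exists (fun x => flat n.+2 x + - n%:R * flat n.+1 x); last exact: has_deriv_flat.
  apply: smooth_algD; first exact: smooth_alg_flat.
  by apply: smooth_algM; [exact: smooth_alg_cst|exact: smooth_alg_flat].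
- by exists (fun x => f' x + g' x); [exact: smooth_algD|
    move=> x; exact: has_derivD].
- exists (fun x => f' x * g x + f x * g' x); last by move=> x; exact: has_derivM.
  by apply: smooth_algD; exact: smooth_algM.
- exists (fun x => - 1 * f' x * ((f x)^-1 * (f x)^-1)).
    apply: smooth_algM; last by apply: smooth_algM; exact: smooth_algV.
    by apply: smooth_algM => //; exact: smooth_alg_cst.
  move=> x; have := f0 x => fx0; have dfx := df x; deriv_tac.
  by rewrite -expr2 exprVn mulN1r.
- exists (fun x => f' (a * x + c) * a).
    by apply: smooth_algM; [exact: smooth_alg_affine|exact: smooth_alg_cst].
  move=> x; apply: has_deriv_comp => //.
  by deriv_tac; rewrite mul0r add0r mulr1 addr0.
Qed.

Lemma smooth_algW f : smooth_alg f -> smooth f.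
Proof. by apply: smooth_coind; exact: smooth_alg_has_deriv. Qed.

(** A transition from [0] on []-oo, -1]] to [1] on [[1, +oo[]. The arguments [x + 1] and [1 - x] sum
    to [2], so one of them is positive and the denominator never vanishes. *)
Definition step (x : R) : R :=
  flat 0 (x + 1) / (flat 0 (x + 1) + flat 0 (1 - x)).

Lemma flat0_ge0 x : 0 <= flat 0 x.
Proof. by rewrite /flat; case: ifP => // _; rewrite expr0 invr1 mul1r expR_ge0. Qed.

Lemma flat0_gt0 x : 0 < x -> 0 < flat 0 x.
Proof. by rewrite /flat => ->; rewrite expr0 invr1 mul1r expR_gt0. Qed.

Lemma flat0_eq0 x : x <= 0 -> flat 0 x = 0.
Proof. by rewrite /flat ltNge => ->. Qed.

Lemma step_denom_gt0 x : 0 < flat 0 (x + 1) + flat 0 (1 - x).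
Proof.
have [x1|x1] := ltP x 1.
  by rewrite ltr_wpDl ?flat0_ge0// flat0_gt0// subr_gt0.
by rewrite ltr_pwDl ?flat0_ge0// flat0_gt0//; lra.
Qed.

Lemma step_alg : smooth_alg step.
Proof.
have E1 : (fun x : R => flat 0 (x + 1)) = (fun x => flat 0 (1 * x + 1)).
  by apply/funext => x; rewrite mul1r.
have E2 : (fun x : R => flat 0 (1 - x)) = (fun x => flat 0 (-1 * x + 1)).
  by apply/funext => x; rewrite mulN1r addrC.
have A1 : smooth_alg (fun x : R => flat 0 (x + 1)).
  by rewrite E1; exact: (smooth_alg_affine _ _ (smooth_alg_flat 0)).
have A2 : smooth_alg (fun x : R => flat 0 (1 - x)).
  by rewrite E2; exact: (smooth_alg_affine _ _ (smooth_alg_flat 0)).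
apply: smooth_algM => //; apply: smooth_algV; last exact: smooth_algD.
by move=> x; rewrite gt_eqF// step_denom_gt0.
Qed.

Lemma step_smooth : smooth step. Proof. exact: smooth_algW step_alg. Qed.

Lemma step_eq0 x : x <= -1 -> step x = 0.
Proof. by move=> x1; rewrite /step flat0_eq0 ?mul0r//; lra. Qed.

Lemma step_eq1 x : 1 <= x -> step x = 1.
Proof.
move=> x1; rewrite /step (@flat0_eq0 (1 - x)) ?addr0 ?divff ?gt_eqF//.
  by rewrite flat0_gt0//; lra.
lra.
Qed.

Lemma step_bounds x : 0 <= step x <= 1.
Proof.
rewrite /step divr_ge0 ?addr_ge0 ?flat0_ge0//= ler_pdivrMr ?step_denom_gt0//.
by rewrite mul1r lerDl flat0_ge0.
Qed.

Lemma derive1_step_eq0 x : 1 < `|x| -> derive1 step x = 0.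
Proof.
move=> x1.
suff H : has_deriv step x 0.
  exact: has_deriv_unique (smooth_has_deriv step_smooth x) H.
have [x0|x0] := leP 0 x.
- apply: (has_deriv_near _ (has_deriv_cst 1 x)).
  near=> y; rewrite step_eq1// ltW//; near: y; apply: lt_nbhsr.
  by rewrite -(ger0_norm x0).
- apply: (has_deriv_near _ (has_deriv_cst 0 x)).
  near=> y; rewrite step_eq0// ltW//; near: y; apply: lt_nbhsl.
  by rewrite ltrNr -(ltr0_norm x0).
Unshelve. all: by end_near. Qed.

End SmoothFunctions.

(** * Lebesgue integrals of real functions *)

Section RealIntegrals.
Local Open Scope classical_set_scope.
Variable R : realType.
Local Notation leb := (@lebesgue_measure R).
Implicit Types (f g F : R -> R) (a b x : R) (D E : set R).

Lemma lebesgue_integrableD D f g : measurable D ->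
  leb.-integrable D (EFin \o f) -> leb.-integrable D (EFin \o g) ->
  leb.-integrable D (EFin \o (fun x => f x + g x)).
Proof. by move=> mD fi gi; exact: (@integrableD _ _ _ leb D mD _ _ fi gi). Qed.

Lemma lebesgue_integrableB D f g : measurable D ->
  leb.-integrable D (EFin \o f) -> leb.-integrable D (EFin \o g) ->
  leb.-integrable D (EFin \o (fun x => f x - g x)).
Proof. by move=> mD fi gi; exact: (@integrableB _ _ _ leb D mD _ _ fi gi). Qed.

Lemma lebesgue_integrableZ D f (c : R) : measurable D ->
  leb.-integrable D (EFin \o f) ->
  leb.-integrable D (EFin \o (fun x => c * f x)).
Proof. by move=> mD fi; exact: (@integrableZl _ _ _ leb D mD c _ fi). Qed.

Lemma lebesgue_integrable_cst D (c : R) : measurable D -> (leb D < +oo)%E ->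
  leb.-integrable D (EFin \o (fun=> c)).
Proof.
move=> mD Dy; apply: measurable_bounded_integrable => //.
by exists `|c|; split; [exact: num_real|move=> y cy x _; exact: ltW].
Qed.

Lemma lebesgue_le_integrable D f g : measurable D -> measurable_fun D f ->
  (forall x, D x -> `|f x| <= g x) ->
  leb.-integrable D (EFin \o g) -> leb.-integrable D (EFin \o f).
Proof.
move=> mD mf fg; apply: (@le_integrable _ _ _ leb D mD).
  exact/measurable_EFinP.
by move=> x Dx /=; rewrite lee_fin (le_trans (fg _ Dx))// ler_norm.
Qed.

Lemma Rintegral_support D E f : E `<=` D ->
  (forall x, D x -> ~ E x -> f x = 0) ->
  \int[leb]_(x in D) f x = \int[leb]_(x in E) f x.
Proof.
move=> ED f0; rewrite Rintegral_mkcond [RHS]Rintegral_mkcond.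
apply: eq_Rintegral => x _; rewrite !patchE.
case: ifPn => [/set_mem Dx|/negP nDx]; case: ifPn => [/set_mem Ex|/negP nEx] //.
- by apply: f0 => // Ex; apply: nEx; exact/mem_set.
- by exfalso; apply: nDx; exact/mem_set/ED.
Qed.

Lemma integrable_support D E f : measurable D -> measurable E -> E `<=` D ->
  (forall x, D x -> ~ E x -> f x = 0) ->
  leb.-integrable E (EFin \o f) -> leb.-integrable D (EFin \o f).
Proof.
move=> mD mE ED f0 fE.
have iE := proj1 (@integrable_mkcond _ _ R leb _ _ mE) fE.
apply: (proj2 (@integrable_mkcond _ _ R leb _ _ mD)).
apply: eq_integrable iE => // x _.
rewrite !patchE.
case: ifPn => [/set_mem Ex|/negP nEx]; case: ifPn => [/set_mem Dx|/negP nDx] //=.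
- by exfalso; apply: nDx; exact/mem_set/ED.
- by rewrite f0// => Ex; apply: nEx; exact/mem_set.
Qed.

(** The case [a = b] is included because the exhaustion of the half-line used below starts with a
    segment reduced to a point. *)
Lemma FTC_has_deriv f F a b : a <= b ->
  (forall x, a <= x <= b -> has_deriv F x (f x)) ->
  (forall x, a <= x <= b -> {for x, continuous f}) ->
  leb.-integrable `[a, b] (EFin \o f) /\
  \int[leb]_(x in `[a, b]) f x = F b - F a.
Proof.
move=> ab dF cf.
have wf : {within `[a, b], continuous f}.
  apply: continuous_in_subspaceT => x /set_mem; rewrite /= in_itv/=; exact: cf.
split; first by apply: continuous_compact_integrable => //; exact: segment_compact.
move: ab; rewrite le_eqVlt => /predU1P[<-|ab].
  by rewrite set_itv1 Rintegral_set1 subrr.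
rewrite /Rintegral (@continuous_FTC2 _ f F)//.
  split.
  - by move=> x; rewrite in_itv/= => /andP[ax xb]; case: (dF x) => //; rewrite !ltW.
  - apply: cvg_at_right_filter; apply: has_deriv_continuous (dF a _).
    by rewrite lexx ltW.
  - apply: cvg_at_left_filter; apply: has_deriv_continuous (dF b _).
    by rewrite lexx ltW.
move=> x; rewrite in_itv/= => /andP[ax xb]; rewrite derive1E.
by case: (dF x) => //; rewrite !ltW.
Qed.

Lemma bounded_of_support f M : continuous f ->
  (forall x, M < `|x| -> f x = 0) -> exists2 C, 0 <= C & forall x, `|f x| <= C.
Proof.
(* [M] may be negative; with [|M|] the segment contains [0]. *)
move=> cf f0; pose N := `|M|.
have cN : {within `[- N, N], continuous (fun x => `|f x|)}.
  apply: continuous_subspaceT => x; apply: continuous_comp; first exact: cf.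
  exact: norm_continuous.
have NN : - N <= N by rewrite (@le_trans _ _ 0)// ?oppr_le0 /N.
have [c _ cmax] := EVT_max NN cN.
exists `|f c| => // x; have [xN|Nx] := leP `|x| N.
  by apply: cmax; rewrite in_itv/= -ler_norml.
by rewrite f0 ?normr0// (le_lt_trans _ Nx)// ler_norm.
Qed.

Lemma integrable_bounded_mul D f g C : measurable D ->
  leb.-integrable D (EFin \o f) -> measurable_fun D g ->
  (forall x, D x -> `|g x| <= C) ->
  leb.-integrable D (EFin \o (fun x => f x * g x)).
Proof.
move=> mD fi mg gC.
have bg : [bounded g x | x in D].
  exists C; split; first exact: num_real.
  by move=> y Cy x Dx /=; rewrite (le_trans (gC _ Dx))// ltW.
by move: (@integrableMl _ _ _ leb D mD _ g fi mg bg); apply: eq_integrable.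
Qed.

Lemma measurable_half_line : measurable (@half_line R).
Proof. exact: measurable_itv. Qed.

Lemma half_lineE x : half_line x = (0 < x) :> Prop.
Proof. by rewrite /half_line /= in_itv/= andbT. Qed.

End RealIntegrals.

(** * Rescaled steps and the associated mollifiers *)

Section StepKernel.
Local Open Scope classical_set_scope.
Variable R : realType.
Local Notation leb := (@lebesgue_measure R).
Implicit Types (f g F : R -> R) (a b x h : R).

Definition step_at a h x : R := step (h^-1 * (x - a)).

(** A mollifier centred at [a], of mass one, supported in [[a - h, a + h]]. It is the derivative of
    [step_at a h], so testing a weak derivative against steps brings out values of [f] as [h] tends
    to [0]. *)
Definition kernel_at a h x : R := derive1 (@step R) (h^-1 * (x - a)) * h^-1.

Lemma step_at_has_deriv a h x : has_deriv (step_at a h) x (kernel_at a h x).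
Proof.
apply: has_deriv_comp; first exact: smooth_has_deriv (@step_smooth R) _.
by deriv_tac; rewrite mul0r add0r subr0 mulr1.
Qed.

Lemma step_at_alg a h : smooth_alg (step_at a h).
Proof.
rewrite (_ : step_at a h = fun x => step (h^-1 * x + - (h^-1 * a))).
  exact: smooth_alg_affine (@step_alg R).
by apply/funext => x; rewrite /step_at mulrBr.
Qed.

Lemma step_at_eq0 a h x : 0 < h -> x <= a - h -> step_at a h x = 0.
Proof.
move=> h0 xa; rewrite /step_at step_eq0// ler_pdivrMl//.
by rewrite mulrN1; lra.
Qed.

Lemma step_at_eq1 a h x : 0 < h -> a + h <= x -> step_at a h x = 1.
Proof.
by move=> h0 xa; rewrite /step_at step_eq1// ler_pdivlMl// mulr1; lra.
Qed.

Lemma kernel_at_eq0 a h x : 0 < h -> h < `|x - a| -> kernel_at a h x = 0.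
Proof.
move=> h0 xa; rewrite /kernel_at derive1_step_eq0 ?mul0r//.
by rewrite normrM gtr0_norm ?invr_gt0// ltr_pdivlMl// mulr1.
Qed.

Lemma kernel_at_continuous a h : continuous (kernel_at a h).
Proof.
move=> x; have sd := smooth_has_deriv (smooth_derive1 (@step_smooth R)).
apply: (has_deriv_continuous (a:=_)).
apply: has_derivM; last exact: has_deriv_cst.
apply: has_deriv_comp; first exact: sd.
by repeat deriv_step.
Qed.

Lemma step_derive_bounded :
  exists2 C : R, 0 <= C & forall x, `|derive1 (@step R) x| <= C.
Proof.
apply: (@bounded_of_support _ _ 1); last by move=> x; exact: derive1_step_eq0.
move=> x; apply: has_deriv_continuous (smooth_has_deriv _ x).
exact: smooth_derive1 (@step_smooth R).
Qed.

(** The radius [2 * h] makes the open ball, the kind of set over which Lebesgue averages are taken,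
    contain the closed support of the kernel. *)
Lemma Rintegral_kernel_at a h : 0 < h ->
  \int[leb]_(x in ball a (2 * h)) kernel_at a h x = 1.
Proof.
move=> h0; rewrite (@Rintegral_support _ _ `[a - h, a + h]); last 2 first.
- by move=> x /=; rewrite in_itv/= /ball/= distrC ltr_distl => /andP[? ?]; lra.
- move=> x _ /=; rewrite in_itv/= => /negP; rewrite -ler_distl -ltNge.
  exact: kernel_at_eq0.
have [_ ->] := @FTC_has_deriv _ (kernel_at a h) (step_at a h) (a - h) (a + h)
  ltac:(lra) (fun x _ => step_at_has_deriv a h x)
  (fun x _ => @kernel_at_continuous a h x).
by rewrite step_at_eq1 ?step_at_eq0 ?subr0//; lra.
Qed.

End StepKernel.

(** * Weak derivatives at Lebesgue points *)

Section WeakDerivatives.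
Local Open Scope classical_set_scope.
Variable R : realType.
Local Notation leb := (@lebesgue_measure R).
Local Notation hl := (@half_line R).
Implicit Types (f g F : R -> R) (a b x h : R).

(** The error is at most [C / h] times the integral of [|f - f a|] over a ball of measure [4 * h],
    that is [4 * C] times the average [davg], which tends to [0] at a Lebesgue point. *)
Lemma kernel_at_cvg f p q a : p < a -> a < q ->
  leb.-integrable `[p, q] (EFin \o f) -> lebesgue_pt f a ->
  (\int[leb]_(x in ball a (2 * h)) (f x * kernel_at a h x)) @[h --> 0^'+]
    --> f a.
Proof.
move=> pa aq fi fa; have [C C0 sC] := step_derive_bounded R.
have davg2 : davg f a (2 * h) @[h --> (0:R)^'+] --> 0%E.
  apply: (cvg_comp (fun h : R => 2 * h) (davg f a) _ fa).
  move=> A [e /= e0 eA]; exists (e / 2) => /=; first by rewrite divr_gt0.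
  move=> y /= ye y0; apply: eA; last by rewrite mulr_gt0.
  move: ye; rewrite /= !sub0r !normrN normrM (gtr0_norm (ltr0Sn _ 1)).
  by rewrite ltr_pdivlMr// mulrC.
have davgC : ((4 * C)%:E * davg f a (2 * h))%E @[h --> (0:R)^'+] --> 0%E.
  by rewrite -(mule0 (4 * C)%:E); exact: cvgeZl.
suff H : \forall h \near (0:R)^'+,
    (`|f a - \int[leb]_(x in ball a (2 * h)) (f x * kernel_at a h x)|%:E <=
     (4 * C)%:E * davg f a (2 * h))%E.
  apply/cvgrPdist_le => e e0.
  have /fine_cvgP [finC cvgC] := davgC.
  move/cvgr0Pnorm_le : cvgC => /(_ _ e0) cvgC.
  near=> h; rewrite -lee_fin.
  have Hh : (`|f a - \int[leb]_(x in ball a (2 * h)) (f x * kernel_at a h x)|%:E <=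
     (4 * C)%:E * davg f a (2 * h))%E by near: h.
  apply: (le_trans Hh).
  have fh : ((4 * C)%:E * davg f a (2 * h))%E \is a fin_num by near: h.
  rewrite -(fineK fh) lee_fin (le_trans (ler_norm _))//.
  by near: h; exact: cvgC.
near=> h.
have h0 : 0 < h by near: h; exact: nbhs_right_gt.
have hp : 2 * h < a - p.
  rewrite mulrC -ltr_pdivlMr//; near: h; apply: nbhs_right_lt.
  by rewrite divr_gt0// subr_gt0.
have hq : 2 * h < q - a.
  rewrite mulrC -ltr_pdivlMr//; near: h; apply: nbhs_right_lt.
  by rewrite divr_gt0// subr_gt0.
pose B : set R := ball a (2 * h).
have mB : measurable B by exact: measurable_ball.
have Bpq : B `<=` `[p, q].
  move=> x; rewrite /B /ball/= distrC ltr_distl in_itv/= => /andP[? ?].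
  by apply/andP; split; lra.
have fB : leb.-integrable B (EFin \o f) by exact: integrableS fi.
have muB : (leb B < +oo)%E by rewrite lebesgue_measure_ball ?ltry// mulr_ge0// ltW.
have cB c := @lebesgue_integrable_cst _ B c mB muB.
have mk : measurable_fun B (kernel_at a h).
  apply: measurable_funTS; apply: continuous_measurable_fun.
  exact: kernel_at_continuous.
have kC x : `|kernel_at a h x| <= C / h.
  by rewrite /kernel_at normrM (gtr0_norm (x := h^-1)) ?invr_gt0// ler_pM2r ?invr_gt0.
have ik (f' : R -> R) : leb.-integrable B (EFin \o f') ->
    leb.-integrable B (EFin \o (fun x => f' x * kernel_at a h x)).
  by move=> f'B; apply: integrable_bounded_mul f'B mk _ => // x _; exact: kC.
have fB' : leb.-integrable B (EFin \o (fun x => f x - f a)).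
  exact: lebesgue_integrableB.
have kB : leb.-integrable B (EFin \o kernel_at a h).
  by have := ik _ (cB 1); under eq_fun do rewrite /= mul1r.
(* Mass one allows the constant [f a] to be moved under the integral. *)
have E1 : f a - \int[leb]_(x in B) (f x * kernel_at a h x) =
    - \int[leb]_(x in B) ((f x - f a) * kernel_at a h x).
  under [in RHS]eq_Rintegral do rewrite mulrBl.
  rewrite RintegralB//; [|exact: ik|exact: ik].
  by rewrite RintegralZl// Rintegral_kernel_at// mulr1 opprB.
rewrite E1 normrN.
have n1 : `|\int[leb]_(x in B) ((f x - f a) * kernel_at a h x)| <=
    \int[leb]_(x in B) (C / h * `|f x - f a|).
  apply: (le_trans (le_normr_Rintegral _ _)) => //; first exact: ik.
  apply: le_Rintegral => //.
  - by have := integrable_norm (ik _ fB').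
  - exact: lebesgue_integrableZ (integrable_norm fB').
  - by move=> x _; rewrite normrM mulrC ler_wpM2r.
rewrite -lee_fin in n1; apply: (le_trans n1).
have nB : leb.-integrable B (EFin \o (fun x => `|f x - f a|)).
  exact: integrable_norm fB'.
rewrite RintegralZl// /davg /iavg lebesgue_measure_ball ?mulr_ge0// ?(ltW h0)//.
rewrite inver mulrn_eq0/= mulf_eq0 pnatr_eq0/= (gt_eqF h0).
rewrite -[X in (_ <= _ * (_ * X))%E]fineK; last first.
  exact: integrable_fin_num nB.
rewrite -!EFinM lee_fin le_eqVlt; apply/orP; left; apply/eqP.
rewrite -[LHS]/(C / h * fine _) mulrA; congr (_ * _).
by rewrite mulr2n; field; apply/andP; split; apply: lt0r_neq0; lra.
Unshelve. all: by end_near. Qed.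
Lemma ae_neq a : {ae leb, forall x, x <> a}.
Proof.
exists [set a]; split; [exact: measurable_set1|exact: lebesgue_measure_set1|].
by move=> x /= /contrapT ->.
Qed.

Lemma harmonic_scaled_cvg0 a : a / n.+1%:R @[n --> \oo] --> (0 : R).
Proof.
by rewrite -(mulr0 a); apply: cvgM; [exact: cvg_cst|exact: cvg_harmonic].
Qed.

(* Tested against [step_at a h - step_at b h], which tends to the indicator of
   [[a, b]] as [h] tends to [0]. *)
Lemma wderiv_lebesgue_pt f g a b : is_wderiv f g -> 0 < a -> a < b ->
  lebesgue_pt f a -> lebesgue_pt f b ->
  \int[leb]_(x in `[a, b]) g x = f b - f a.
Proof.
move=> [fi gi fg] a0 ab fa fb.
(* Widths at most [a / 4] keep the supports, and the balls of radius [2 * h n], inside []0, +oo[]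
   for every [n]. *)
pose h (n : nat) : R := a / 4 / n.+1%:R.
have h0 n : 0 < h n by rewrite !divr_gt0.
have ha n : h n <= a / 4 by rewrite ler_pdivrMr// ler_peMr ?divr_ge0 ?(ltW a0)// ler1n.
have hcvg : h n @[n --> \oo] --> (0 : R) by exact: harmonic_scaled_cvg0.
have h2cvg : (2 * h n) @[n --> \oo] --> (0 : R).
  by rewrite -(mulr0 2); apply: cvgM => //; exact: cvg_cst.
pose psi n x := step_at a (h n) x - step_at b (h n) x.
have [C C0 sC] := step_derive_bounded R.
pose D : set R := `[a / 4, b + a].
have mD : measurable D by exact: measurable_itv.
have Dhl : D `<=` hl.
  by move=> x; rewrite half_lineE /D /= in_itv/= => /andP[? _]; lra.
have fD : leb.-integrable D (EFin \o f) by apply: fi; lra.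
have gD : leb.-integrable D (EFin \o g) by apply: gi; lra.
have psi0 n x : ~ D x -> psi n x = 0.
  have := ha n; have := h0 n => ? ?; rewrite /D /= in_itv/= => /negP.
  rewrite negb_and -!ltNge => /orP[?|?]; rewrite /psi.
    by rewrite !step_at_eq0 ?subrr//; lra.
  by rewrite !step_at_eq1 ?subrr//; lra.
have psic n : continuous (psi n).
  move=> x; apply: has_deriv_continuous.
  by apply: has_derivB; exact: step_at_has_deriv.
have psiC n : Cc_open (psi n).
  split.
    apply: smooth_algW.
    rewrite (_ : psi n = fun x => step_at a (h n) x + -1 * step_at b (h n) x).
      apply: smooth_algD; first exact: step_at_alg.
      by apply: smooth_algM; [exact: smooth_alg_cst|exact: step_at_alg].
    by apply/funext => x; rewrite mulN1r.
  exists (a / 4), (b + a); split; [lra|lra|move=> x /negP xD; exact: psi0].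
have dpsi n : derive1 (psi n) = fun x => kernel_at a (h n) x - kernel_at b (h n) x.
  by apply: has_deriv_derive1 => x; apply: has_derivB; exact: step_at_has_deriv.
have ker c n : (c == a) || (c == b) ->
    leb.-integrable hl (EFin \o (fun x => f x * kernel_at c (h n) x)) /\
    \int[leb]_(x in hl) (f x * kernel_at c (h n) x) =
    \int[leb]_(x in ball c (2 * h n)) (f x * kernel_at c (h n) x).
  move=> cab; have := ha n; have := h0 n => hn ?.
  have ac : a <= c <= b.
    by case/orP: cab => /eqP ->; rewrite lexx ltW.
  case/andP: ac => ac cb.
  split.
    apply: (@integrable_support _ _ D) => //; first exact: measurable_half_line.
      move=> x _; rewrite /D /= in_itv/= => /negP xD.
      rewrite kernel_at_eq0 ?mulr0//.
      rewrite ltNge; apply: contra xD; rewrite ler_distl => /andP[? ?].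
      by apply/andP; split; lra.
    apply: (@integrable_bounded_mul _ _ _ _ (C / h n)) => //.
      apply: measurable_funTS; apply: continuous_measurable_fun.
      exact: kernel_at_continuous.
    move=> x _; rewrite /kernel_at normrM (gtr0_norm (x := (h n)^-1)) ?invr_gt0//.
    by rewrite ler_pM2r ?invr_gt0.
  apply: Rintegral_support.
    move=> x; rewrite half_lineE /ball/= distrC ltr_distl => /andP[? _]; lra.
  move=> x _; rewrite /ball/= distrC => /negP; rewrite -leNgt => hx.
  by rewrite kernel_at_eq0 ?mulr0// (lt_le_trans _ hx)//; lra.
have kcvg c : (c == a) || (c == b) -> lebesgue_pt f c ->
    integ (fun x => f x * kernel_at c (h n) x) @[n --> \oo] --> f c.
  move=> cab fc; rewrite /integ; under eq_cvg do rewrite (ker _ _ cab).2.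
  have ac : a <= c <= b.
    by case/orP: cab => /eqP ->; rewrite lexx ltW.
  have p1 : a / 4 < c by lra.
  have p2 : c < b + a by lra.
  by have /cvg_at_rightP := kernel_at_cvg p1 p2 fD fc; apply; split.
have L : integ (fun x => f x * derive1 (psi n) x) @[n --> \oo] --> f a - f b.
  have -> : (fun n => integ (fun x => f x * derive1 (psi n) x)) = fun n =>
     integ (fun x => f x * kernel_at a (h n) x) -
     integ (fun x => f x * kernel_at b (h n) x).
    apply/funext => n; rewrite /integ dpsi.
    under eq_Rintegral do rewrite mulrBr.
    rewrite RintegralB//; first exact: measurable_half_line.
      by apply: (ker _ _ _).1; rewrite eqxx.
    by apply: (ker _ _ _).1; rewrite eqxx orbT.
  by apply: cvgB; apply: kcvg; rewrite ?eqxx ?orbT.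
have psi1 n x : `|psi n x| <= 1.
  have /andP[? ?] := step_bounds ((h n)^-1 * (x - a)).
  have /andP[? ?] := step_bounds ((h n)^-1 * (x - b)).
  by rewrite ler_norml /psi /step_at; apply/andP; split; lra.
have gpsi n : leb.-integrable D (EFin \o (fun x => g x * psi n x)).
  apply: (@integrable_bounded_mul _ _ _ _ 1) => //.
  by apply: measurable_funTS; exact: continuous_measurable_fun.
have gab : leb.-integrable `[a, b] (EFin \o g) by exact: gi.
have abD : `[a, b] `<=` D.
  by move=> x; rewrite /D /= !in_itv/= => /andP[? ?]; apply/andP; split; lra.
have G : integ (fun x => g x * psi n x) @[n --> \oo] --> \int[leb]_(x in `[a, b]) g x.
  have -> : (fun n => integ (fun x => g x * psi n x)) =
      fun n => \int[leb]_(x in D) (g x * psi n x).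
    apply/funext => n; apply: Rintegral_support => // x _ xD.
    by rewrite psi0// mulr0.
  have -> : \int[leb]_(x in `[a, b]) g x = \int[leb]_(x in D) (g \_ `[a, b]) x.
    by rewrite -Rintegral_mkcondr (setIidr abD).
  have gabD : leb.-integrable D (EFin \o g \_ `[a, b]).
    apply: (@integrable_support _ _ `[a, b]) => //.
      by move=> x _ xab; rewrite patchE memNset.
    by apply: eq_integrable gab => // x xab; rewrite /= patchE xab.
  apply: fine_cvg; rewrite fineK; last exact: integrable_fin_num gabD.
  case: (@dominated_convergence _ _ R leb D mD
    (fun n x => (g x * psi n x)%:E) (fun x => ((g \_ `[a, b]) x)%:E)
    (fun x => `|g x|%:E)) => //.
  - by move=> n; case/integrableP: (gpsi n).
  - by case/integrableP: gabD.
  (* At [a] and at [b] the test functions tend to [step 0 = 1/2] instead of [1]; these two points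
     are null. *)
  - have na := ae_neq a; have nb := ae_neq b.
    near=> x; move=> Dx.
    have xa : x <> a by near: x.
    have xb : x <> b by near: x.
    apply: cvg_near_cst; rewrite patchE.
    have [xlta|axlt] := ltP x a.
      have hx : \forall n \near \oo, h n < a - x.
        by apply: cvgr_lt hcvg _ _; rewrite subr_gt0.
      near=> n; have hn : h n < a - x by near: n.
      rewrite memNset; last by rewrite /= in_itv/= leNgt xlta.
      by rewrite /psi !step_at_eq0 ?subrr ?mulr0//; lra.
    have ax : a < x by rewrite lt_neqAle axlt eq_sym andbT; apply/eqP.
    have [xb1|bx1] := ltP x b.
      have hx : \forall n \near \oo, h n < Num.min (x - a) (b - x).
        by apply: cvgr_lt hcvg _ _; rewrite lt_min !subr_gt0 ax.
      near=> n; have : h n < Num.min (x - a) (b - x) by near: n.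
      rewrite lt_min => /andP[? ?].
      rewrite mem_set; last by rewrite /= in_itv/= !ltW.
      by rewrite /psi step_at_eq1 ?step_at_eq0 ?subr0 ?mulr1//; lra.
    have bx : b < x by rewrite lt_neqAle bx1 eq_sym andbT; apply/eqP.
    have hx : \forall n \near \oo, h n < x - b.
      by apply: cvgr_lt hcvg _ _; rewrite subr_gt0.
    near=> n; have hn : h n < x - b by near: n.
    rewrite memNset; last by rewrite /= in_itv/= axlt leNgt bx.
    by rewrite /psi !step_at_eq1 ?subrr ?mulr0//; lra.
  - exact: integrable_norm gD.
  - apply: aeW => x n _; rewrite lee_fin normrM.
    by rewrite -[leRHS]mulr1 ler_wpM2l.
have G' : - integ (fun x => g x * psi n x) @[n --> \oo] -->
    - \int[leb]_(x in `[a, b]) g x by exact: cvgN.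
rewrite (_ : (fun n => _) = fun n => integ (fun x => f x * derive1 (psi n) x)) in G'.
  have E : - (\int[leb]_(x in `[a, b]) g x) = f a - f b.
    exact: (@cvg_unique _ (@Rhausdorff R) _ _ _ _ G' L).
  by rewrite -[LHS]opprK E opprB.
by apply/funext => n; rewrite fg.
Unshelve. all: by end_near. Qed.

End WeakDerivatives.

(** * Continuous representatives on the half-line *)

Section ContinuousRepresentative.
Local Open Scope classical_set_scope.
Variable R : realType.
Local Notation leb := (@lebesgue_measure R).
Local Notation hl := (@half_line R).
Implicit Types (f g F G : R -> R) (a b x y : R).

Definition loc_integrable g : Prop := forall a b, 0 < a -> a < b ->
  leb.-integrable `[a, b] (EFin \o g).

(** Local absolute continuity in integral form: insensitive to the representative chosen for [g]. *)
Definition primitive_on_hl F g : Prop := forall x y, 0 < x -> x <= y ->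
  \int[leb]_(t in `[x, y]) g t = F y - F x.

Lemma loc_integrableW g a b : loc_integrable g -> 0 < a -> a <= b ->
  leb.-integrable `[a, b] (EFin \o g).
Proof.
move=> gi a0; rewrite le_eqVlt => /predU1P[<-|]; last exact: gi.
by apply: (integrableS _ _ _ (gi a (a + 1) _ _)) => //;
  [move=> x /=; rewrite !in_itv/= => /andP[? ?]; apply/andP; split; lra|lra].
Qed.

(** Integrability may fail at [0] and at infinity, so Lebesgue's theorem is applied to the
    truncations of [f] to compact segments. Around an interior point of a segment, averages over
    small balls do not see the truncation. *)
Lemma ae_lebesgue_pt f : loc_integrable f ->
  {ae leb, forall x, 0 < x -> lebesgue_pt f x}.
Proof.
move=> fi; pose K n : set R := `[n.+1%:R^-1, n.+2%:R].
have K0 n : n.+1%:R^-1 < n.+2%:R :> R.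
  by rewrite (@le_lt_trans _ _ 1)// ?invf_le1// ?ler1n// ltr1n.
have fK n : leb.-integrable (K n) (EFin \o f) by apply: fi.
have H : forall n, {ae leb, forall x, lebesgue_pt (f \_ (K n)) x}.
  move=> n; apply: lebesgue_differentiation.
  by apply: integrable_locally => //; exact: measurable_itv.
have {H} := ae_foralln H; apply: filterS => x Hx x0.
have xi : 0 < x^-1 by rewrite invr_gt0.
pose n := Num.bound (x + x^-1).
have xn : x + x^-1 < n.+1%:R.
  by rewrite (lt_trans (archi_boundP _))// ?addr_ge0 ?ltW// ltr_nat.
have x2 : x < n.+2%:R.
  by rewrite (@lt_trans _ _ n.+1%:R)// ?ltr_nat//; lra.
have x1 : n.+1%:R^-1 < x by rewrite -[ltRHS]invrK ltf_pV2 ?posrE//; lra.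
have := Hx n; apply: cvg_trans; apply: near_eq_cvg.
rewrite /K.
have nd := @near_davg _ f (BLeft n.+1%:R^-1) x n.+2%:R x2.
have {}nd := nd x1.
by apply: filterS nd => r ->.
Qed.

Lemma ae_half_line_ex (P : R -> Prop) a b : {ae leb, forall x, 0 < x -> P x} ->
  0 <= a -> a < b -> exists x, [/\ a < x, x < b & P x].
Proof.
move=> [A [mA A0 PA]] a0 ab; apply: contrapT => nex.
suff : (leb `]a, b[ <= leb A)%E.
  by rewrite A0 lebesgue_measure_itv/= lte_fin ab -EFinD lee_fin leNgt subr_gt0 ab.
apply: le_measure; rewrite ?inE//.
move=> x; rewrite /= in_itv/= => /andP[ax xb]; apply: PA => Px.
by apply: nex; exists x; split => //; apply: Px; exact: le_lt_trans ax.
Qed.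

Lemma Rintegral_itv_split g a b c : loc_integrable g ->
  0 < a -> a <= b -> b <= c ->
  \int[leb]_(t in `[a, c]) g t =
  \int[leb]_(t in `[a, b]) g t + \int[leb]_(t in `[b, c]) g t.
Proof.
move=> gi a0 ab bc; have gac := loc_integrableW gi a0 (le_trans ab bc).
have gbc := loc_integrableW gi (lt_le_trans a0 ab) bc.
have E : \int[leb]_(t in `[a, c]) g t - \int[leb]_(t in `[a, b]) g t =
    \int[leb]_(t in `]b, c]) g t.
  by apply: Rintegral_itvB => //; rewrite bnd_simp.
have E2 : \int[leb]_(t in `]b, c]) g t = \int[leb]_(t in `[b, c]) g t.
  apply: Rintegral_itv_obnd_cbnd; apply: integrableS gbc => //.
  exact: subset_itv_oc_cc.
by rewrite -E2 -E addrC subrK.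
Qed.

(** The primitive of [g] is anchored at a Lebesgue point [c] of [f], where the value [f c] can be
    trusted; it then agrees with [f] at every Lebesgue point. *)
Lemma wderiv_primitive f g : is_wderiv f g ->
  exists2 F, ae_eq_half_line f F & primitive_on_hl F g.
Proof.
move=> fg; have [fi gi _] := fg.
have aef := ae_lebesgue_pt fi.
have [c [c0 _ cf]] := @ae_half_line_ex _ 0 1 aef (lexx 0) ltr01.
(* Two cases, because integrals over segments are not oriented. *)
pose F x := f c + (if c <= x then \int[leb]_(t in `[c, x]) g t
                   else - \int[leb]_(t in `[x, c]) g t).
exists F.
  rewrite /ae_eq_half_line; move: aef; apply: (@filterS _ _ (ae_filter_ringOfSetsType leb)) => x xf.
  rewrite half_lineE => x0.
  rewrite /F; have [cx|xc|cx] := ltgtP c x.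
  - by rewrite (wderiv_lebesgue_pt fg)//; [lra|exact: xf].
  - by rewrite (wderiv_lebesgue_pt fg)//; [lra|exact: xf].
  - by rewrite -cx set_itv1 Rintegral_set1 addr0.
move=> x y x0 xy; rewrite /F.
have [cx|xc] := leP c x; have [cy|yc] := leP c y.
- by rewrite (Rintegral_itv_split gi c0 cx xy); lra.
- by exfalso; lra.
- by rewrite (Rintegral_itv_split gi x0 (ltW xc) cy); lra.
- by rewrite (Rintegral_itv_split gi x0 xy (ltW yc)); lra.
Qed.

Lemma primitive_has_deriv F g x : loc_integrable g -> primitive_on_hl F g ->
  0 < x -> lebesgue_pt g x -> has_deriv F x (g x).
Proof.
move=> gi Fg x0 gx; have x2 : 0 < x / 2 by lra.
have gx2 : leb.-integrable `[x / 2, x + 1] (EFin \o g) by apply: gi; lra.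
have xx1 : x < x + 1 by lra.
have xx2 : x / 2 < x by lra.
have [dG GE] := FTC1_lebesgue_pt xx1 gx2 xx2 gx.
apply: (@has_deriv_near _
    (fun y => F (x / 2) + \int[leb]_(t in `[x / 2, y]) g t)).
  near=> y; rewrite Fg//; first by lra.
  by apply: ltW; near: y; apply: lt_nbhsr; lra.
have D : has_deriv (fun y => \int[leb]_(t in `[x / 2, y]) g t) x (g x).
  by split => //; rewrite -derive1E.
by deriv_tac; rewrite add0r.
Unshelve. all: by end_near. Qed.

Lemma primitive_ae_has_deriv F g : loc_integrable g -> primitive_on_hl F g ->
  {ae leb, forall x, 0 < x -> has_deriv F x (g x)}.
Proof.
move=> gi Fg; have := ae_lebesgue_pt gi.
apply: (@filterS _ _ (ae_filter_ringOfSetsType leb)) => x gx x0.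
by apply: primitive_has_deriv => //; exact: gx.
Qed.

Lemma primitive_continuous F g : loc_integrable g -> primitive_on_hl F g ->
  forall x, 0 < x -> {for x, continuous F}.
Proof.
move=> gi Fg x x0; have x2 : 0 < x / 2 by lra.
have xx : x / 2 < x + 1 by lra.
have gx2 := gi _ _ x2 xx.
have := parameterized_integral_continuous (ltW xx) gx2.
move=> /(continuous_within_itvP _ xx)[+ _ _].
move=> /(_ x); rewrite in_itv/= => H.
have {H}cG : {for x, continuous (fun y => \int[leb]_(t in `[x / 2, y]) g t)}.
  by apply: H; apply/andP; split; lra.
have cG2 : {for x, continuous (fun y => F (x / 2) + \int[leb]_(t in `[x / 2, y]) g t)}.
  by apply: cvgD => //; exact: cvg_cst.
rewrite /prop_for /continuous_at in cG2 *.
have E y : x / 2 <= y -> F (x / 2) + \int[leb]_(t in `[x / 2, y]) g t = F y.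
  by move=> y2; rewrite Fg//; lra.
rewrite E in cG2; last lra.
apply: cvg_trans cG2; apply: near_eq_cvg.
near=> y; apply: E; apply: ltW; near: y; apply: lt_nbhsr; lra.
Unshelve. all: by end_near. Qed.

Lemma continuous_hl_measurable G : (forall x, 0 < x -> {for x, continuous G}) ->
  measurable_fun hl G.
Proof.
move=> cG; apply: open_continuous_measurable_fun; first exact: interval_open.
by move=> x; rewrite inE half_lineE; exact: cG.
Qed.

(** The passage from weak to classical: exchanging [g] for [G] changes no integral, and every point
    of continuity of [G] is one of its Lebesgue points. *)
Lemma primitive_has_deriv_continuous F g G :
  loc_integrable g -> primitive_on_hl F g -> ae_eq_half_line g G ->
  (forall x, 0 < x -> {for x, continuous G}) ->
  forall x, 0 < x -> has_deriv F x (G x).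
Proof.
move=> gi Fg gG cG x x0; have mG := continuous_hl_measurable cG.
have sub a b : 0 < a -> `[a, b] `<=` hl.
  by move=> a0 y; rewrite half_lineE /= in_itv/= => /andP[? _]; lra.
have Gi : loc_integrable G.
  move=> a b a0 ab; apply: continuous_compact_integrable.
    exact: segment_compact.
  apply: continuous_in_subspaceT => y /set_mem/(sub _ _ a0); rewrite half_lineE.
  exact: cG.
apply: primitive_has_deriv => //.
  move=> a b a0 ab; rewrite -Fg//; congr fine; apply: ae_eq_integral => //=.
  - by case/integrableP: (loc_integrableW Gi a0 ab).
  - by case/integrableP: (loc_integrableW gi a0 ab).
  - by move: gG; apply: (@filterS _ _ (ae_filter_ringOfSetsType leb)) => y gy /(sub _ _ a0) /gy ->.
apply: (@continuous_lebesgue_pt _ _ _ hl) => //; last exact: cG.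
- by split; [exact: interval_open|rewrite half_lineE].
- exact: measurable_half_line.
Qed.

(** If they differed at [x], they would differ on an interval, and an interval is not null. *)
Lemma ae_eq_hl_continuous F G :
  (forall x, 0 < x -> {for x, continuous F}) ->
  (forall x, 0 < x -> {for x, continuous G}) ->
  ae_eq_half_line F G -> forall x, 0 < x -> F x = G x.
Proof.
move=> cF cG FG x x0; apply: contrapT => /eqP nFG.
have cD : {for x, continuous (fun y => F y - G y)}.
  by apply: cvgB; [exact: cF|exact: cG].
have nD : 0 < `|F x - G x| by rewrite normr_gt0 subr_eq0.
have /cvgrPdist_lt /(_ _ nD) [e /= e0 He] := cD.
have FG' : {ae leb, forall y, 0 < y -> F y = G y}.
  by move: FG; apply: (@filterS _ _ (ae_filter_ringOfSetsType leb)) => y; rewrite half_lineE.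
have [y [xy ye yE]] := @ae_half_line_ex _ x (x + e) FG' (ltW x0) ltac:(lra).
have := He y; rewrite /ball_/= ltr_distl.
have -> : F y - G y = 0 by rewrite yE subrr.
by rewrite subr0 ltxx => H; have := H ltac:(apply/andP; split; lra).
Qed.

End ContinuousRepresentative.

(** * Kummer's function and its differential equation *)

Section Kummer.
Local Open Scope classical_set_scope.
Variable R : realType.
Implicit Types (u : nat -> R) (a c x : R).

(** Domination by the coefficients of an exponential series: it gives convergence on the whole line
    and is stable under termwise differentiation. *)
Definition exp_bounded u : Prop :=
  exists A M : R, [/\ 0 <= A, 0 <= M & forall n, `|u n| <= A * (M ^+ n / n`!%:R)].

Lemma exp_bounded_diffs u : exp_bounded u -> exp_bounded (pseries_diffs u).
Proof.
move=> [A [M [A0 M0 uM]]]; exists (A * M), M; split => // [|n].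
  exact: mulr_ge0.
rewrite /pseries_diffs normrM ger0_norm ?ler0n//.
apply: le_trans (ler_wpM2l _ (uM n.+1)) _ => //.
rewrite le_eqVlt; apply/orP; left; apply/eqP.
rewrite factS natrM exprS; field.
by rewrite !pnatr_eq0 -lt0n fact_gt0/= addrC natr1 pnatr_eq0.
Qed.

Lemma exp_bounded_cvg u x : exp_bounded u -> cvgn (pseries u x).
Proof.
move=> [A [M [A0 M0 uM]]]; apply: normed_cvg.
apply: (@series_le_cvg _ _ (fun n => A * exp_coeff (M * `|x|) n)).
- by move=> n /=.
- by move=> n; rewrite mulr_ge0// exp_coeff_ge0// mulr_ge0.
- move=> n /=; rewrite normrM normrX /exp_coeff/=.
  apply: le_trans (ler_wpM2r _ (uM n)) _; first exact: exprn_ge0.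
  by rewrite exprMn -!mulrA [_^-1 * _]mulrC.
- have := @is_cvg_series_exp_coeff R (M * `|x|).
  by move=> /(@is_cvg_seriesZ _ _ A).
Qed.

Definition entire u x : R := limn (pseries u x).

Lemma entire_has_deriv u x : exp_bounded u ->
  has_deriv (entire u) x (entire (pseries_diffs u) x).
Proof.
move=> bu; have b1 := exp_bounded_diffs bu; have b2 := exp_bounded_diffs b1.
apply: (@pseries_snd_diffs _ _ (`|x| + 1)).
- exact: exp_bounded_cvg.
- exact: exp_bounded_cvg.
- exact: exp_bounded_cvg.
by rewrite [ltRHS]ger0_norm ?addr_ge0// ltrDl.
Qed.

Definition kummer_coef a c (n : nat) : R := poch a n / poch c n / n`!%:R.

Lemma kummerE a c : kummer a c = entire (kummer_coef a c).
Proof.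
apply/funext => x; rewrite /kummer /entire /pseries; congr (limn (series _)).
by apply/funext => n; rewrite /kummer_coef mulrA mulrAC.
Qed.

Lemma poch_gt0 c n : 0 < c -> 0 < poch c n.
Proof. by move=> c0; apply: prodr_gt0 => i _; rewrite ltr_wpDr. Qed.

Lemma pochS c n : poch c n.+1 = poch c n * (c + n%:R).
Proof. by rewrite /poch big_ord_recr. Qed.

Lemma kummer_coef_bounded a c : 0 < c -> exp_bounded (kummer_coef a c).
Proof.
(* Chosen so that [|a + n| <= M (c + n)] for every [n]. *)
move=> c0; pose M := `|a| / c + 1.
have M0 : 0 <= M by rewrite addr_ge0// divr_ge0// ltW.
exists 1, M; split => // n; rewrite mul1r /kummer_coef normrM.
rewrite [X in _ * X]ger0_norm ?invr_ge0 ?ler0n//.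
rewrite ler_pM2r ?invr_gt0 ?ltr0n ?fact_gt0//.
rewrite normrM normfV (gtr0_norm (poch_gt0 n c0)) ler_pdivrMr ?poch_gt0//.
elim: n => [|n IH]; first by rewrite /poch !big_ord0 normr1 expr0 mulr1.
rewrite !pochS normrM exprSr mulrACA ler_pM//.
apply: (le_trans (ler_normD _ _)); rewrite (ger0_norm (ler0n _ n)) /M.
have -> : (`|a| / c + 1) * (c + n%:R) = `|a| + n%:R + (c + `|a| / c * n%:R).
  by field; rewrite gt_eqF.
by rewrite lerDl addr_ge0 ?mulr_ge0 ?invr_ge0// ltW.
Qed.

Lemma kummer_coef_rec a c n : 0 < c ->
  n.+1%:R * (c + n%:R) * kummer_coef a c n.+1 = (a + n%:R) * kummer_coef a c n.
Proof.
move=> c0; rewrite /kummer_coef !pochS factS natrM.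
field; rewrite !gt_eqF ?poch_gt0 ?ltr0n ?fact_gt0//.
by rewrite ltr_wpDr.
Qed.

Definition kummer1 a c := entire (pseries_diffs (kummer_coef a c)).
Definition kummer2 a c := entire (pseries_diffs (pseries_diffs (kummer_coef a c))).

Lemma kummer_has_deriv a c x : 0 < c ->
  has_deriv (kummer a c) x (kummer1 a c x).
Proof.
by move=> c0; rewrite kummerE; apply/entire_has_deriv/kummer_coef_bounded.
Qed.

Lemma kummer1_has_deriv a c x : 0 < c ->
  has_deriv (kummer1 a c) x (kummer2 a c x).
Proof.
move=> c0; apply: entire_has_deriv.
exact/exp_bounded_diffs/kummer_coef_bounded.
Qed.

Lemma kummer0 a c : kummer a c 0 = 1.
Proof.
rewrite /kummer; apply: lim_near_cst => //; near=> n.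
have n0 : (0 < n)%N by near: n; exact: nbhs_infty_gt.
rewrite -(prednK n0) /series/= big_nat_recl// big1 ?addr0.
  by rewrite /poch !big_ord0 ?expr0 ?fact0 !divr1 mulr1.
by move=> i _; rewrite exprS mul0r mul0r mulr0.
Unshelve. all: by end_near. Qed.

(** By the recurrence on the coefficients, the partial sums [S N] of the left-hand side telescope to
    [w N - v N]. Shifted by one index, [w] and [v] are [x] times general terms of convergent series,
    so both tend to [0]. *)
Lemma kummer_ode a c x : 0 < c ->
  x * kummer2 a c x + (c - x) * kummer1 a c x - a * kummer a c x = 0.
Proof.
move=> c0; have b0 := kummer_coef_bounded a c0.
have b1 := exp_bounded_diffs b0; have b2 := exp_bounded_diffs b1.
have c00 := exp_bounded_cvg (x := x) b0.
have c01 := exp_bounded_cvg (x := x) b1.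
have c02 := exp_bounded_cvg (x := x) b2.
set k := kummer_coef a c in b0 b1 b2 c00 c01 c02.
pose S N := x * pseries (pseries_diffs (pseries_diffs k)) x N
  + (c - x) * pseries (pseries_diffs k) x N - a * pseries k x N.
pose w n := n%:R * pseries_diffs k n * x ^+ n.
pose v n := n%:R * k n * x ^+ n.
have SE N : S N = w N - v N.
  elim: N => [|N IH].
    by rewrite /S /w /v /pseries/= /series/= !big_geq// !mulr0 !mul0r !subr0 addr0.
  have -> : S N.+1 = S N + (x * (pseries_diffs (pseries_diffs k) N * x ^+ N)
    + (c - x) * (pseries_diffs k N * x ^+ N) - a * (k N * x ^+ N)).
    by rewrite /S /pseries/= /series/= !big_nat_recr//=; ring.
  rewrite IH /w /v /pseries_diffs !exprS.
  have := kummer_coef_rec a N c0; rewrite -/k => kr.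
  have -> : N.+1%:R = N%:R + 1 :> R by rewrite natr1.
  have -> : N.+2%:R = N%:R + 2 :> R by rewrite -[N.+2]addn2 natrD.
  rewrite -[N.+1%:R]natr1 in kr.
  have : x ^+ N * ((N%:R + 1) * (c + N%:R) * k N.+1) = x ^+ N * ((a + N%:R) * k N).
    by rewrite kr.
  move: (x ^+ N) (k N) (k N.+1) (k N.+2) (N%:R : R) => X k0 k1 k2 m H.
  move/eqP: H; rewrite -subr_eq0 => /eqP H.
  by apply/eqP; rewrite -subr_eq0 -[X in _ == X]H; apply/eqP; ring.
have cS : S N @[N --> \oo] --> x * kummer2 a c x + (c - x) * kummer1 a c x
    - a * kummer a c x.
  rewrite kummerE; apply: cvgB; [apply: cvgD|]; apply: cvgM => //; exact: cvg_cst.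
have shift u : u N @[N --> \oo] --> (0 : R) -> x * u N @[N --> \oo] --> (0 : R).
  by move=> u0; rewrite -[X in _ --> X](mulr0 x); apply: cvgM => //; exact: cvg_cst.
have w0 : w N @[N --> \oo] --> (0 : R).
  rewrite -(cvg_shiftS w) (_ : (fun n => _) =
      fun n => x * (pseries_diffs (pseries_diffs k) n * x ^+ n)).
    exact/shift/cvg_series_cvg_0.
  by apply/funext => n; rewrite /w /pseries_diffs exprS -!natr1; ring.
have v0 : v N @[N --> \oo] --> (0 : R).
  rewrite -(cvg_shiftS v) (_ : (fun n => _) =
      fun n => x * (pseries_diffs k n * x ^+ n)).
    exact/shift/cvg_series_cvg_0.
  by apply/funext => n; rewrite /v /pseries_diffs exprS -!natr1; ring.
have S0 : S N @[N --> \oo] --> (0 : R).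
  rewrite (_ : S = fun n => w n - v n); last exact/funext.
  by rewrite -(subr0 0); exact: cvgB.
exact: (@cvg_unique _ (@Rhausdorff R) _ _ _ _ cS S0).
Qed.

Definition kummer_sol al be x : R := expR (- x) * kummer (al - be) al x.

Definition kummer_sol1 al be x : R :=
  expR (- x) * (kummer1 (al - be) al x - kummer (al - be) al x).

Definition kummer_sol2 al be x : R :=
  expR (- x) * (kummer2 (al - be) al x - 2 * kummer1 (al - be) al x
                + kummer (al - be) al x).

Lemma kummer_sol_has_deriv al be x : 0 < al ->
  has_deriv (kummer_sol al be) x (kummer_sol1 al be x).
Proof.
move=> al0; have d0 := kummer_has_deriv (al - be) x al0.
by deriv_tac; rewrite /kummer_sol1; ring.
Qed.

Lemma kummer_sol1_has_deriv al be x : 0 < al ->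
  has_deriv (kummer_sol1 al be) x (kummer_sol2 al be x).
Proof.
move=> al0; have d0 := kummer_has_deriv (al - be) x al0.
have d1 := kummer1_has_deriv (al - be) x al0.
by deriv_tac; rewrite /kummer_sol2; ring.
Qed.

(** Writing a function as [exp(- x) w] turns this equation into Kummer's equation for [w] with
    parameters [al - be] and [al]. *)
Lemma kummer_sol_ode al be x : 0 < al ->
  x * kummer_sol2 al be x + (al + x) * kummer_sol1 al be x
  + be * kummer_sol al be x = 0.
Proof.
move=> al0; have := kummer_ode (al - be) x al0 => E.
rewrite /kummer_sol2 /kummer_sol1 /kummer_sol.
rewrite (_ : _ + _ = expR (- x) * (x * kummer2 (al - be) al x
  + (al - x) * kummer1 (al - be) al x - (al - be) * kummer (al - be) al x)).
  by rewrite E mulr0.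
by ring.
Qed.

Lemma kummer_sol_at0 al be : kummer_sol al be 0 = 1.
Proof. by rewrite /kummer_sol oppr0 expR0 kummer0 mulr1. Qed.

End Kummer.

(** * Exhaustion of the half-line by compact segments *)

Section Exhaustion.
Local Open Scope classical_set_scope.
Variable R : realType.
Local Notation leb := (@lebesgue_measure R).
Local Notation hl := (@half_line R).
Implicit Types (f g h B b : R -> R) (x y : R).

Definition exh (n : nat) : set R := `[n.+1%:R^-1, n.+1%:R].

Lemma exh_gt0 n x : exh n x -> 0 < x.
Proof.
by rewrite /exh /= in_itv/= => /andP[nx _]; rewrite (lt_le_trans _ nx)// invr_gt0.
Qed.

Lemma exh_sub n : exh n `<=` hl.
Proof. by move=> x /exh_gt0; rewrite half_lineE. Qed.

Lemma exh_measurable n : measurable (exh n). Proof. exact: measurable_itv. Qed.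

Lemma exh_endpoints n : n.+1%:R^-1 <= n.+1%:R :> R.
Proof. by rewrite (@le_trans _ _ 1)// ?invf_le1// ler1n. Qed.

Lemma exh_homo : {homo exh : n m / (n <= m)%N >-> (n <= m)%O}.
Proof.
move=> n m nm; apply/subsetPset => x; rewrite /exh /= !in_itv/= => /andP[nx xn].
apply/andP; split; last by rewrite (le_trans xn)// ler_nat.
by apply: le_trans nx; rewrite lef_pV2 ?posrE ?ltr0n ?ler_nat.
Qed.

Lemma exh_mem x : 0 < x -> \forall n \near \oo, exh n x.
Proof.
move=> x0; have xi : 0 < x^-1 by rewrite invr_gt0.
exists (Num.bound (x + x^-1)) => // n /= Nn.
have xn : x + x^-1 < n.+1%:R.
  apply: (@lt_le_trans _ _ (Num.bound (x + x^-1))%:R).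
    by rewrite archi_boundP// addr_ge0// ltW.
  by rewrite ler_nat ltnW.
rewrite /exh /= in_itv/=; apply/andP; split; last by lra.
by rewrite -[leRHS]invrK lef_pV2 ?posrE//; lra.
Qed.

Lemma exh_bigcup : \bigcup_n exh n = hl.
Proof.
apply/seteqP; split => [x [n _] /exh_sub//|x].
by rewrite half_lineE => /exh_mem[n _ /(_ n (leqnn n))]; exists n.
Qed.

Lemma loc_integrable_exh g n : loc_integrable g ->
  leb.-integrable (exh n) (EFin \o g).
Proof.
by move=> gi; apply: loc_integrableW => //; exact: exh_endpoints.
Qed.

Lemma loc_integrable_measurable g : loc_integrable g -> measurable_fun hl g.
Proof.
move=> gi; rewrite -exh_bigcup; apply/(measurable_fun_bigcup _ exh_measurable) => n.
by have /integrableP[/measurable_EFinP] := loc_integrable_exh n gi.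
Qed.

Lemma integrable_hl_loc g : integrable_hl g -> loc_integrable g.
Proof.
move=> gi a b a0 ab; apply: integrableS gi => //; first exact: measurable_half_line.
by move=> x; rewrite half_lineE /= in_itv/= => /andP[? _]; lra.
Qed.

Lemma continuous_loc_integrable g : (forall x, 0 < x -> {for x, continuous g}) ->
  loc_integrable g.
Proof.
move=> cg a b a0 ab; apply: continuous_compact_integrable.
  exact: segment_compact.
apply: continuous_in_subspaceT => y /set_mem; rewrite /= in_itv/= => /andP[ay _].
by apply: cg; lra.
Qed.

(** Monotone convergence, used at once as an integrability test and as an upper bound. *)
Lemma integrable_exhaustion g C : (forall x, 0 < x -> 0 <= g x) ->
  loc_integrable g ->
  (forall n, \int[leb]_(x in exh n) g x <= C) ->
  integrable_hl g /\ integ g <= C.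
Proof.
move=> g0 gi gC.
have cv := @ge0_nondecreasing_set_cvg_integral _ (measurableTypeR R) R exh (EFin \o g) leb
  exh_homo exh_measurable
  (fun n => measurable_int leb (loc_integrable_exh n gi))
  (fun n x xn => (g0 x (exh_gt0 xn) : (0 <= (g x)%:E)%E)).
rewrite exh_bigcup in cv.
have gCn n : (\int[leb]_(x in exh n) (g x)%:E <= C%:E)%E.
  rewrite -[leLHS]fineK; first by rewrite lee_fin; exact: gC.
  by apply: integrable_fin_num (loc_integrable_exh n gi); exact: exh_measurable.
have gle : (\int[leb]_(x in hl) (g x)%:E <= C%:E)%E.
  by apply: (cvge_to_le cv); near=> n; exact: gCn.
have iG : integrable_hl g.
  apply/integrableP; split.
    by apply/measurable_EFinP; exact: loc_integrable_measurable.
  apply: le_lt_trans (ltry C); apply: le_trans gle; rewrite le_eqVlt; apply/orP; left.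
  apply/eqP; apply: eq_integral => x /set_mem; rewrite half_lineE => x0 /=.
  by rewrite ger0_norm// g0.
split => //; rewrite -lee_fin /integ /Rintegral fineK//.
by apply: (@integrable_fin_num _ _ _ leb hl); [exact: measurable_half_line|exact: iG].
Unshelve. all: by end_near. Qed.

Lemma exhaustion_cvg g : integrable_hl g ->
  \int[leb]_(x in exh n) g x @[n --> \oo] --> integ g.
Proof.
move=> gi; have mhl := @measurable_half_line R.
have mg : measurable_fun hl g by exact: (loc_integrable_measurable (integrable_hl_loc gi)).
have E n : \int[leb]_(x in exh n) g x = \int[leb]_(x in hl) (g \_ (exh n)) x.
  by rewrite -Rintegral_mkcondr setIidr//; exact: exh_sub.
under eq_cvg do rewrite E.
apply: fine_cvg; rewrite fineK; last exact: integrable_fin_num gi.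
have mgn n : measurable_fun hl (g \_ (exh n)).
  have := @measurable_restrict _ _ _ _ (exh n) hl g (exh_measurable n) mhl.
  by move=> <-; apply: measurable_funS mg => // x [].
case: (@dominated_convergence _ _ R leb hl mhl
    (fun n x => ((g \_ (exh n)) x)%:E) (fun x => (g x)%:E)
    (fun x => `|g x|%:E)) => //.
- by move=> n; apply/measurable_EFinP; exact: mgn.
- exact/measurable_EFinP.
- apply: aeW => x; rewrite half_lineE => /exh_mem xn.
  apply: cvg_near_cst; near=> n; rewrite patchE mem_set//; near: n; exact: xn.
- exact: integrable_norm gi.
- apply: aeW => x n _; rewrite lee_fin patchE; case: ifP => // _.
  by rewrite normr0.
Unshelve. all: by end_near. Qed.

(** The form taken by integration by parts. As the integral of [b] converges, it is enough that the
    boundary term at [0] vanish along the left ends of the exhaustion. *)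
Lemma integ0_of_primitive B b : (forall x, 0 < x -> has_deriv B x (b x)) ->
  (forall x, 0 < x -> {for x, continuous b}) -> integrable_hl b ->
  B (n.+1%:R^-1) @[n --> \oo] --> (0 : R) ->
  (exists M, forall x, M < x -> B x = 0) -> integ b = 0.
Proof.
move=> dB cb bi B0 [M BM].
have E n : \int[leb]_(x in exh n) b x = B n.+1%:R - B n.+1%:R^-1.
  have [] // := @FTC_has_deriv _ b B _ _ (exh_endpoints n).
  - by move=> x /andP[nx _]; apply: dB; rewrite (lt_le_trans _ nx)// invr_gt0.
  - by move=> x /andP[nx _]; apply: cb; rewrite (lt_le_trans _ nx)// invr_gt0.
have := exhaustion_cvg bi; under eq_cvg do rewrite E.
move=> cv; suff cv0 : B n.+1%:R - B n.+1%:R^-1 @[n --> \oo] --> (0 : R).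
  exact: (@cvg_unique _ (@Rhausdorff R) _ _ _ _ cv cv0).
rewrite -[X in _ --> X](subr0 0); apply: cvgB => //.
apply: cvg_near_cst; near=> n; apply: BM.
have : (Num.bound `|M| <= n)%N by near: n; exact: nbhs_infty_ge.
move=> Mn; rewrite (le_lt_trans (ler_norm M))// (lt_le_trans (archi_boundP _))//.
by rewrite ler_nat ltnW.
Unshelve. all: by end_near. Qed.

Lemma powR_continuous p x : 0 < x -> {for x, continuous (fun y : R => y `^ p)}.
Proof. by move=> x0; apply: has_deriv_continuous (has_deriv_powR p x0). Qed.

(* [(x / (1 + x)) ^ q] is bounded, and its derivative is comparable with
   [x ^ (q - 1)] on bounded sets. *)
Lemma integrable_powR_weight p : -1 < p ->
  integrable_hl (fun x => (x / (1 + x)) `^ p / (1 + x) ^+ 2).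
Proof.
move=> p1; pose q := p + 1; have q0 : 0 < q by rewrite /q; lra.
pose G x := q^-1 * (x / (1 + x)) `^ q.
have y0 x : 0 < x -> 0 < x / (1 + x) by move=> x0; rewrite divr_gt0//; lra.
have n0 x : 0 < x -> 1 + x != 0 by move=> x0; rewrite gt_eqF//; lra.
have dy x : 0 < x -> has_deriv (fun y => y / (1 + y)) x ((1 + x) ^- 2).
  move=> x0; have xn := n0 x x0; deriv_tac.
  by field.
have dG x : 0 < x -> has_deriv G x ((x / (1 + x)) `^ p / (1 + x) ^+ 2).
  move=> x0; have H := @has_deriv_comp _ (fun y => y `^ q) (fun y => y / (1 + y)) _ _ _
    (has_deriv_powR q (y0 x x0)) (dy x x0).
  deriv_tac; rewrite /q addrK; field.
  by rewrite n0//=; rewrite /q in q0; rewrite gt_eqF.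
have cg x : 0 < x -> {for x, continuous (fun y => (y / (1 + y)) `^ p / (1 + y) ^+ 2)}.
  move=> x0; have xn := n0 x x0; have xn2 : (1 + x) ^+ 2 != 0 by rewrite expf_neq0.
  have H := @has_deriv_comp _ (fun y => y `^ p) (fun y => y / (1 + y)) _ _ _
    (has_deriv_powR p (y0 x x0)) (dy x x0).
  by apply: has_deriv_continuous; repeat deriv_step.
apply: (@integrable_exhaustion _ q^-1 _ _ _).1.
- by move=> x x0; rewrite divr_ge0 ?powR_ge0 ?sqr_ge0.
- exact: continuous_loc_integrable.
move=> n; have [] := @FTC_has_deriv _ (fun x => (x / (1 + x)) `^ p / (1 + x) ^+ 2) G _ _
  (exh_endpoints n).
- by move=> x /andP[nx _]; apply: dG; rewrite (lt_le_trans _ nx)// invr_gt0.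
- by move=> x /andP[nx _]; apply: cg; rewrite (lt_le_trans _ nx)// invr_gt0.
move=> _ ->; rewrite /G -mulrBr ler_piMr ?invr_ge0 ?(ltW q0)// lerBlDr.
rewrite ler_wpDr ?powR_ge0//.
apply: (@le_trans _ _ (1 `^ q)); last by rewrite powR1.
have n1 : (0 : R) < n.+1%:R by rewrite ltr0n.
apply: ge0_ler_powR; [exact: ltW|by rewrite nnegrE ltW// y0|by rewrite nnegrE|].
by rewrite ler_pdivrMr ?mul1r; lra.
Qed.

Lemma integrable_powR_support h p M : continuous h -> -1 < p ->
  (forall x, M < `|x| -> h x = 0) ->
  integrable_hl (fun x => h x * x `^ p).
Proof.
move=> ch p1 hM; have [C C0 hC] := bounded_of_support ch hM.
have iw := integrable_powR_weight p1.
(* The quotient of [x^p] by the integrable weight is [(1 + x)^(p + 2)], at most [N] on the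
   support. *)
pose N := (1 + `|M|) `^ (p + 2).
have mhl := @measurable_half_line R.
have iD := lebesgue_integrableZ (C * N) mhl iw.
apply: lebesgue_le_integrable iD => //.
  apply: loc_integrable_measurable; apply: continuous_loc_integrable => x x0.
  by apply: cvgM; [exact: ch|exact: powR_continuous].
move=> x; rewrite half_lineE => x0; have x1 : 0 < 1 + x by lra.
rewrite normrM (ger0_norm (powR_ge0 _ _)).
have [Mx|xM] := ltP M `|x|.
  rewrite hM// normr0 mul0r !mulr_ge0 ?powR_ge0 ?invr_ge0 ?sqr_ge0//.
rewrite -mulrA ler_pM ?powR_ge0//.
have -> : (x / (1 + x)) `^ p / (1 + x) ^+ 2 = x `^ p / (1 + x) `^ (p + 2).
  rewrite powRM ?invr_ge0 ?ltW// -powR_inv1 ?ltW// -powRrM mulN1r powRN.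
  rewrite -mulrA -invfM; congr (_ / _).
  rewrite powRD; last by rewrite (gt_eqF x1) implybT.
  by rewrite -powR_mulrn// ltW.
rewrite mulrC -mulrA ler_peMr ?powR_ge0// ler_pdivlMl ?powR_gt0// mulr1.
apply: ge0_ler_powR; rewrite ?nnegrE; [lra|exact: ltW|by rewrite addr_ge0|].
by rewrite lerD2l (le_trans _ (ler_norm M))// (le_trans (ler_norm x)).
Qed.

Lemma powR_bounded_cvg0 h p C : 0 < p -> (forall x, `|h x| <= C) ->
  h (n.+1%:R^-1) * (n.+1%:R^-1) `^ p @[n --> \oo] --> (0 : R).
Proof.
move=> p0 hC.
have pc : (n.+1%:R^-1) `^ p @[n --> \oo] --> (0 : R).
  have /cvg_at_rightP := @powR_cvg0 R p p0; apply; split => //.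
  exact: cvg_harmonic.
have Cp : C * (n.+1%:R^-1) `^ p @[n --> \oo] --> (0 : R).
  by rewrite -[X in _ --> X](mulr0 C); apply: cvgM => //; exact: cvg_cst.
apply/norm_cvg0P; apply: squeeze_cvgr Cp; last exact: cvg_cst.
near=> n; rewrite normr_ge0/= normrM (ger0_norm (powR_ge0 _ _)).
by rewrite ler_wpM2r ?powR_ge0.
Unshelve. all: by end_near. Qed.

End Exhaustion.

(** * Convergence in weighted L^2 *)

Section WeightedL2.
Local Open Scope classical_set_scope.
Variable R : realType.
Local Notation leb := (@lebesgue_measure R).
Local Notation hl := (@half_line R).
Implicit Types (f g h w : R -> R) (x y c : R).

Let mhl := @measurable_half_line R.

Lemma integrable_hlD f g : integrable_hl f -> integrable_hl g ->
  integrable_hl (fun x => f x + g x).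
Proof. exact: lebesgue_integrableD. Qed.

Lemma integrable_hlB f g : integrable_hl f -> integrable_hl g ->
  integrable_hl (fun x => f x - g x).
Proof. exact: lebesgue_integrableB. Qed.

Lemma integrable_hlZ c f : integrable_hl f -> integrable_hl (fun x => c * f x).
Proof. exact: lebesgue_integrableZ. Qed.

Lemma integrable_hl_eq f g : (forall x, 0 < x -> f x = g x) ->
  integrable_hl f -> integrable_hl g.
Proof.
move=> fg; apply: eq_integrable => // x /set_mem; rewrite half_lineE => x0.
by rewrite /= fg.
Qed.

Lemma integrable_hl_measurable f : integrable_hl f -> measurable_fun hl f.
Proof. by move=> /integrable_hl_loc /loc_integrable_measurable. Qed.

Lemma integrable_hl_le f g : measurable_fun hl f ->
  (forall x, 0 < x -> `|f x| <= g x) -> integrable_hl g -> integrable_hl f.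
Proof.
move=> mf fg; apply: lebesgue_le_integrable => // x; rewrite half_lineE.
exact: fg.
Qed.

Lemma integD f g : integrable_hl f -> integrable_hl g ->
  integ (fun x => f x + g x) = integ f + integ g.
Proof. exact: RintegralD. Qed.

Lemma integB f g : integrable_hl f -> integrable_hl g ->
  integ (fun x => f x - g x) = integ f - integ g.
Proof. exact: RintegralB. Qed.

Lemma integZ c f : integrable_hl f -> integ (fun x => c * f x) = c * integ f.
Proof. exact: RintegralZl. Qed.

Lemma eq_integ f g : (forall x, 0 < x -> f x = g x) -> integ f = integ g.
Proof.
move=> fg; apply: eq_Rintegral => x /set_mem; rewrite half_lineE; exact: fg.
Qed.

Lemma le_integ f g : integrable_hl f -> integrable_hl g ->
  (forall x, 0 < x -> f x <= g x) -> integ f <= integ g.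
Proof.
by move=> fi gi fg; apply: le_Rintegral => // x; rewrite half_lineE; exact: fg.
Qed.

Lemma integ_ge0 f : (forall x, 0 < x -> 0 <= f x) -> 0 <= integ f.
Proof. by move=> f0; apply: Rintegral_ge0 => x; rewrite half_lineE; exact: f0. Qed.

Lemma integ_EFin f : integrable_hl f ->
  (\int[leb]_(x in hl) (f x)%:E)%E = (integ f)%:E.
Proof.
by move=> fi; rewrite /integ /Rintegral fineK//; exact: integrable_fin_num fi.
Qed.

Lemma integrable_hl_lty f : measurable_fun hl f ->
  (forall x, 0 < x -> 0 <= f x) ->
  (\int[leb]_(x in hl) (f x)%:E < +oo)%E -> integrable_hl f.
Proof.
move=> mf f0 fy; apply/integrableP; split; first exact/measurable_EFinP.
apply: le_lt_trans fy; rewrite le_eqVlt; apply/orP; left; apply/eqP.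
apply: eq_integral => x /set_mem; rewrite half_lineE => x0 /=.
by rewrite ger0_norm// f0.
Qed.

(** Young's inequality with a free parameter [e] plays the part of the triangle inequality for
    norms: with [r = g - gn], [|g^2 - gn^2| <= (1 + 1/e) r^2 + e g^2]. *)
Lemma weighted_L2_cvg (g : R -> R) (gn : nat -> R -> R) w :
  measurable_fun hl g -> (forall n, measurable_fun hl (gn n)) ->
  measurable_fun hl w -> (forall x, 0 < x -> 0 <= w x) ->
  (forall n, integrable_hl (fun x => gn n x ^+ 2 * w x)) ->
  (\int[leb]_(x in hl) ((g x - gn n x) ^+ 2 * w x)%:E)%E @[n --> \oo] --> 0%E ->
  integrable_hl (fun x => g x ^+ 2 * w x) /\
  integ (fun x => gn n x ^+ 2 * w x) @[n --> \oo] -->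
    integ (fun x => g x ^+ 2 * w x).
Proof.
move=> mg mgn mw w0 ign d0.
pose d n x := (g x - gn n x) ^+ 2 * w x.
have md n : measurable_fun hl (d n).
  apply: measurable_funM => //; apply: measurable_funX.
  exact: measurable_funB.
have mg2 : measurable_fun hl (fun x => g x ^+ 2 * w x).
  apply: measurable_funM => //; exact: measurable_funX.
(* The distances are extended reals: their convergence to [0] makes them finite only from some index
   on, hence the filter in the next claim. *)
have dge0 n x : 0 < x -> 0 <= d n x by move=> x0; rewrite mulr_ge0 ?sqr_ge0 ?w0.
have id : \forall n \near \oo, integrable_hl (d n).
  have /fine_cvgP[fd _] := d0; near=> n; apply: integrable_hl_lty => //.
    exact: dge0.
  have : (\int[leb]_(x in hl) ((g x - gn n x) ^+ 2 * w x)%:E)%E \is a fin_num.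
    by near: n; exact: fd.
  by rewrite fin_numE => /andP[_]; rewrite lt_neqAle leey andbT.
have ig : integrable_hl (fun x => g x ^+ 2 * w x).
  have [n _ /(_ n (leqnn n)) idn] := id.
  apply: (integrable_hl_le (g := fun x => 2 * d n x + 2 * (gn n x ^+ 2 * w x))) => //.
    move=> x x0; have gw : 0 <= g x ^+ 2 * w x by rewrite mulr_ge0 ?sqr_ge0 ?w0.
    rewrite (ger0_norm gw) /d !mulrA -mulrDl.
    rewrite ler_wpM2r ?w0// -subr_ge0.
    rewrite (_ : _ - _ = (g x - 2 * gn n x) ^+ 2) ?sqr_ge0//; ring.
  by apply: integrable_hlD; exact: integrable_hlZ.
split => //; set A := integ _.
have A0 : 0 <= A by apply: integ_ge0 => x x0; rewrite mulr_ge0 ?sqr_ge0 ?w0.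
have /fine_cvgP[_ fd0] := d0.
have key n e : 0 < e -> integrable_hl (d n) ->
    `|A - integ (fun x => gn n x ^+ 2 * w x)| <= (1 + e^-1) * integ (d n) + e * A.
  move=> e0 idn; rewrite -integB//.
  apply: (le_trans (le_normr_Rintegral _ _)) => //; first exact: integrable_hlB.
  rewrite -integZ// /A -integZ// -integD; [|exact: integrable_hlZ|exact: integrable_hlZ].
  apply: le_integ.
  - by have := integrable_norm (integrable_hlB ig (ign n)).
  - by apply: integrable_hlD; exact: integrable_hlZ.
  move=> x x0; rewrite -mulrBl normrM (ger0_norm (w0 x x0)) /d (mulrA (1 + e^-1)) (mulrA e) -mulrDl.
  rewrite ler_wpM2r ?w0//; set r := g x - gn n x.
  have -> : gn n x = g x - r by rewrite /r; ring.
  have -> : g x ^+ 2 - (g x - r) ^+ 2 = 2 * (g x * r) - r ^+ 2 by ring.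
  apply: (le_trans (ler_normB _ _)); rewrite (ger0_norm (sqr_ge0 r)).
  rewrite (_ : (1 + e^-1) * r ^+ 2 + _ = r ^+ 2 + (e^-1 * r ^+ 2 + e * g x ^+ 2));
    last by ring.
  rewrite addrC lerD2l normrM (ger0_norm (ler0n _ 2)) normrM.
  have eN : e != 0 by rewrite gt_eqF.
  rewrite -subr_ge0 -[g x ^+ 2]real_normK ?num_real// -[r ^+ 2]real_normK ?num_real//.
  rewrite (_ : _ - _ = e^-1 * (`|r| - e * `|g x|) ^+ 2); last by field.
  by rewrite mulr_ge0 ?sqr_ge0// invr_ge0 ltW.
apply/cvgrPdist_le => e e0.
(* The parameter of Young's inequality, making [dl * A <= e / 2]; [A + 1] allows for [A = 0]. *)
pose dl := e / 2 / (A + 1).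
have A1 : 0 < A + 1 by rewrite ltr_wpDl.
have dl0 : 0 < dl by rewrite !divr_gt0.
have C0 : 0 < 1 + dl^-1 by rewrite addr_gt0// invr_gt0.
near=> n.
have idn : integrable_hl (d n) by near: n.
apply: (le_trans (key n dl dl0 idn)).
have H1 : integ (d n) <= e / 2 / (1 + dl^-1).
  near: n; have eC : 0 < e / 2 / (1 + dl^-1) by rewrite !divr_gt0.
  by have /cvgr0Pnorm_le/(_ _ eC) := fd0; apply: filterS => n; apply/le_trans/ler_norm.
have H2 : (1 + dl^-1) * integ (d n) <= e / 2.
  by rewrite mulrC -ler_pdivlMr.
have H3 : dl * A <= e / 2.
  by rewrite /dl mulrAC ler_pdivrMr// ler_wpM2l ?lerDl// divr_ge0// ltW.
by lra.
Unshelve. all: by end_near. Qed.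

End WeightedL2.

(** * Compactly supported test functions *)

Section CompactSupport.
Local Open Scope classical_set_scope.
Variable R : realType.
Implicit Types (f g h phi : R -> R) (x : R).

Lemma derive1_support phi M : smooth phi ->
  (forall x, M < `|x| -> phi x = 0) ->
  forall x, M < `|x| -> derive1 phi x = 0.
Proof.
move=> sphi phiM x Mx.
apply: has_deriv_unique (smooth_has_deriv sphi x) _.
apply: has_deriv_near (has_deriv_cst 0 x).
have cn : {for x, continuous (fun y : R => `|y|)} by exact: norm_continuous.
have /cvgr_gt/(_ _ Mx) : `|y| @[y --> x] --> `|x| by exact: cn.
by apply: filterS => y My; rewrite phiM.
Qed.

Lemma smooth_continuous phi : smooth phi -> continuous phi.
Proof. by move=> sphi x; apply: has_deriv_continuous (smooth_has_deriv sphi x). Qed.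

Lemma Cc_closed_derivs phi : Cc_closed phi ->
  [/\ continuous phi, continuous (derive1 phi), continuous (derive1 (derive1 phi)) &
   exists M, [/\ forall x, M < `|x| -> phi x = 0,
     forall x, M < `|x| -> derive1 phi x = 0 &
     forall x, M < `|x| -> derive1 (derive1 phi) x = 0]].
Proof.
move=> [sphi [M phiM]]; have s1 := smooth_derive1 sphi.
split.
- exact: smooth_continuous sphi.
- exact: smooth_continuous s1.
- exact: smooth_continuous (smooth_derive1 s1).
exists M; split => //; first exact: derive1_support.
by apply: derive1_support => //; exact: derive1_support.
Qed.

(* The two derivatives are kept as variables, so that unification never unfolds
   [derive1]. *)
Definition test_triple (psi p1 p2 : R -> R) : Prop :=
  [/\ forall x, has_deriv psi x (p1 x), forall x, has_deriv p1 x (p2 x),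
      exists p3 : R -> R, forall x, has_deriv p2 x (p3 x) &
      exists M, forall x, M < `|x| -> [/\ psi x = 0, p1 x = 0 & p2 x = 0]].

Lemma Cc_closed_test_triple psi : Cc_closed psi ->
  test_triple psi (derive1 psi) (derive1 (derive1 psi)).
Proof.
move=> Cpsi; have [_ _ _ [M [M0 M1 M2]]] := Cc_closed_derivs Cpsi.
have [spsi _] := Cpsi; have s1 := smooth_derive1 spsi.
split; [exact: smooth_has_deriv|exact: smooth_has_deriv| |].
  by eexists; exact: (smooth_has_deriv (smooth_derive1 s1)).
by exists M => x Mx; split; [exact: M0|exact: M1|exact: M2].
Qed.

Lemma test_tripleB (p0 p1 p2 q0 q1 q2 : R -> R) :
  test_triple p0 p1 p2 -> test_triple q0 q1 q2 ->
  test_triple (fun x => p0 x - q0 x) (fun x => p1 x - q1 x)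
    (fun x => p2 x - q2 x).
Proof.
move=> [dp0 dp1 [p3 dp2] [M HM]] [dq0 dq1 [q3 dq2] [N HN]]; split.
- by move=> x; exact: has_derivB.
- by move=> x; exact: has_derivB.
- by exists (fun x => p3 x - q3 x) => x; exact: has_derivB.
exists (Num.max M N) => x; rewrite gt_max => /andP[/HM[-> -> ->] /HN[-> -> ->]].
by rewrite subrr.
Qed.

Lemma test_triple_continuous (p0 p1 p2 : R -> R) : test_triple p0 p1 p2 ->
  [/\ continuous p0, continuous p1 & continuous p2].
Proof.
move=> [d0 d1 [p3 d2] _].
by split=> x; [exact: has_deriv_continuous (d0 x)|
  exact: has_deriv_continuous (d1 x)|exact: has_deriv_continuous (d2 x)].
Qed.

End CompactSupport.

(** * Triples approximated in the norm of D_mu *)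

Section ApproximatedTriples.
Local Open Scope classical_set_scope.
Variables (R : realType) (mu : R).
Local Notation leb := (@lebesgue_measure R).
Local Notation hl := (@half_line R).
Implicit Types (f g h w u v d : R -> R) (x y c : R) (phi : nat -> R -> R).

Let mhl := @measurable_half_line R.

Lemma measurable_powR_hl p : measurable_fun hl (fun x : R => x `^ p).
Proof. by apply: measurable_funTS; exact: measurable_powR. Qed.

(** The four integrals of the norm are gathered into one, which reduces each continuity estimate to
    a pointwise inequality between densities. *)
Lemma le_sqnormD v v1 v2 d C : measurable_fun hl v -> measurable_fun hl v1 ->
  measurable_fun hl v2 -> measurable_fun hl d -> 0 <= C ->
  (forall x, 0 < x -> 0 <= d x) ->
  (forall x, 0 < x -> d x <= C * (v2 x ^+ 2 * x `^ (mu + 1) +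
    v1 x ^+ 2 * x `^ (mu + 1) + v1 x ^+ 2 * x `^ (mu - 1) +
    v x ^+ 2 * x `^ (mu - 1))) ->
  (\int[leb]_(x in hl) (d x)%:E <= C%:E * sqnormD mu v v1 v2)%E.
Proof.
move=> mv mv1 mv2 md C0 d0 dC.
have m g p : measurable_fun hl g ->
    measurable_fun hl (fun x => (`|g x| ^+ 2 * x `^ p)%:E).
  move=> mg; apply/measurable_EFinP; apply: measurable_funM.
    by apply: measurable_funX; exact: measurableT_comp.
  exact: measurable_powR_hl.
have p0 g p x : hl x -> (0 <= (`|g x| ^+ 2 * x `^ p)%:E)%E.
  by move=> _; rewrite lee_fin mulr_ge0 ?powR_ge0.
pose F g p (x : R) : \bar R := (`|g x| ^+ 2 * x `^ p)%:E.
have mF2 : measurable_fun hl (fun x => F v2 (mu + 1)%R x + F v1 (mu + 1)%R x)%E.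
  by apply: emeasurable_funD; exact: m.
have mF3 : measurable_fun hl
    (fun x => F v2 (mu + 1)%R x + F v1 (mu + 1)%R x + F v1 (mu - 1)%R x)%E.
  by apply: emeasurable_funD => //; exact: m.
have mF4 : measurable_fun hl (fun x => F v2 (mu + 1)%R x + F v1 (mu + 1)%R x
    + F v1 (mu - 1)%R x + F v (mu - 1)%R x)%E.
  by apply: emeasurable_funD => //; exact: m.
have F0 g p x : hl x -> (0 <= F g p x)%E by exact: p0.
have -> : sqnormD mu v v1 v2 = (\int[leb]_(x in hl) (F v2 (mu + 1)%R x
    + F v1 (mu + 1)%R x + F v1 (mu - 1)%R x + F v (mu - 1)%R x))%E.
  rewrite ge0_integralD//; [|by move=> x hx; rewrite !adde_ge0 ?F0|exact: F0|exact: m].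
  rewrite ge0_integralD//; [|by move=> x hx; rewrite !adde_ge0 ?F0|exact: F0|exact: m].
  by rewrite ge0_integralD//; [exact: F0|exact: m|exact: F0|exact: m].
rewrite -ge0_integralZl//; last by move=> x hx; rewrite !adde_ge0 ?F0.
apply: ge0_le_integral => //.
- by move=> x; rewrite half_lineE lee_fin; exact: d0.
- exact/measurable_EFinP.
- exact: emeasurable_funM.
move=> x; rewrite half_lineE => x0.
rewrite /F -!EFinD -EFinM lee_fin.
by rewrite !real_normK ?num_real// dC.
Qed.

Definition sqdistD (phi phi1 phi2 : nat -> R -> R) (u u1 u2 : R -> R) n : \bar R :=
  sqnormD mu (fun x => u x - phi n x) (fun x => u1 x - phi1 n x)
    (fun x => u2 x - phi2 n x).

(** No derivative links [u], [u1] and [u2]: the identity passes to the limit in the triples alone,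
    and subtracting a fixed test triple stays within the notion. *)
Definition approximates (phi phi1 phi2 : nat -> R -> R) (u u1 u2 : R -> R) : Prop :=
  [/\ measurable_fun hl u, measurable_fun hl u1, measurable_fun hl u2,
      forall n, test_triple (phi n) (phi1 n) (phi2 n) &
      sqdistD phi phi1 phi2 u u1 u2 n @[n --> \oo] --> 0%E].

Lemma wderivP f : weakly_derivable f -> is_wderiv f (wderiv f).
Proof. by move=> [g fg]; rewrite /wderiv; case: xgetP => [h -> //|/(_ g)]. Qed.

Lemma in_D_approximates f : in_D mu f ->
  exists phi phi1 phi2,
    approximates phi phi1 phi2 f (wderiv f) (wderiv (wderiv f)).
Proof.
move=> [/wderivP[fi fi1 _] /wderivP[_ fi2 _] [phi [Cphi cphi]]].
exists phi, (fun n => derive1 (phi n)), (fun n => derive1 (derive1 (phi n))).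
split => //; last by move=> n; exact: Cc_closed_test_triple.
- exact: loc_integrable_measurable.
- exact: loc_integrable_measurable.
- exact: loc_integrable_measurable.
Qed.

Lemma measurable_continuous_hl h : continuous h -> measurable_fun hl h.
Proof. by move=> ch; apply: measurable_funTS; exact: continuous_measurable_fun. Qed.

(** The continuity criterion for one quadratic term of the identity, with [C] the norm of that term
    relative to the norm of D_mu. *)
Lemma approximates_cvg phi phi1 phi2 u u1 u2 g (gn : nat -> R -> R) w C :
  approximates phi phi1 phi2 u u1 u2 ->
  measurable_fun hl g -> (forall n, measurable_fun hl (gn n)) ->
  measurable_fun hl w -> (forall x, 0 < x -> 0 <= w x) -> 0 <= C ->
  (forall n, integrable_hl (fun x => gn n x ^+ 2 * w x)) ->
  (forall n x, 0 < x -> (g x - gn n x) ^+ 2 * w x <=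
    C * ((u2 x - phi2 n x) ^+ 2 * x `^ (mu + 1) +
         (u1 x - phi1 n x) ^+ 2 * x `^ (mu + 1) +
         (u1 x - phi1 n x) ^+ 2 * x `^ (mu - 1) +
         (u x - phi n x) ^+ 2 * x `^ (mu - 1))) ->
  integrable_hl (fun x => g x ^+ 2 * w x) /\
  integ (fun x => gn n x ^+ 2 * w x) @[n --> \oo] -->
    integ (fun x => g x ^+ 2 * w x).
Proof.
move=> [mu0 mu1 mu2 Cphi cphi] mg mgn mw w0 C0 ign H.
apply: weighted_L2_cvg => //.
have cC : (C%:E * sqdistD phi phi1 phi2 u u1 u2 n)%E @[n --> \oo] --> 0%E.
  by rewrite -(mule0 C%:E); exact: cvgeZl.
apply: squeeze_cvge cC; last exact: cvg_cst.
near=> n; apply/andP; split.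
  apply: integral_ge0 => x; rewrite half_lineE => x0.
  by rewrite lee_fin mulr_ge0 ?sqr_ge0// w0.
have [c0 c1 c2] := test_triple_continuous (Cphi n).
apply: le_sqnormD => //.
- by apply: measurable_funB => //; exact: measurable_continuous_hl.
- by apply: measurable_funB => //; exact: measurable_continuous_hl.
- by apply: measurable_funB => //; exact: measurable_continuous_hl.
- apply: measurable_funM => //; apply: measurable_funX.
  exact: measurable_funB.
- by move=> x x0; rewrite mulr_ge0 ?sqr_ge0// w0.
- by move=> x x0; exact: H.
Unshelve. all: by end_near. Qed.

End ApproximatedTriples.

(** * The identity and the Hardy inequality for test functions *)

Section TestFunctions.
Local Open Scope classical_set_scope.
Variable R : realType.
Implicit Types (f g h psi : R -> R) (x p mu al be c : R).

Lemma integrable_hl_cst0 : integrable_hl (fun _ : R => 0).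
Proof. exact: integrable0. Qed.

(** Meant for the M_- term, whose integral may diverge when its coefficient is [0]. *)
Lemma integZ_degenerate c f : c = 0 \/ integrable_hl f ->
  integrable_hl (fun x => c * f x) /\ integ (fun x => c * f x) = c * integ f.
Proof.
move=> [->|fi]; last by split; [exact: integrable_hlZ|exact: integZ].
have -> : (fun x => 0 * f x) = fun=> 0 by apply/funext => x; rewrite mul0r.
split; first exact: integrable_hl_cst0.
by have := integZ 0 integrable_hl_cst0; rewrite !mul0r.
Qed.

Lemma continuous_sqr h : continuous h -> continuous (fun x => h x ^+ 2).
Proof.
move=> ch x; rewrite (_ : (fun x => h x ^+ 2) = fun x => h x * h x).
  by apply: cvgM; exact: ch.
by apply/funext => y; rewrite expr2.
Qed.

Lemma test_triple_integrable (psi p1 p2 : R -> R) p : test_triple psi p1 p2 -> -1 < p ->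
  [/\ integrable_hl (fun x => psi x ^+ 2 * x `^ p),
      integrable_hl (fun x => p1 x ^+ 2 * x `^ p) &
      integrable_hl (fun x => p2 x ^+ 2 * x `^ p)].
Proof.
move=> [d0 d1 [p3 d2] [M H]] p_1.
have I h h' : (forall x, has_deriv h x (h' x)) ->
    (forall x, M < `|x| -> h x = 0) -> integrable_hl (fun x => h x ^+ 2 * x `^ p).
  move=> dh hM; apply: (@integrable_powR_support _ _ _ M) => //.
    by apply: continuous_sqr => x; exact: has_deriv_continuous (dh x).
  by move=> x Mx; rewrite hM// expr0n.
split; [apply: I d0 _|apply: I d1 _|apply: I d2 _] => x Mx; by case: (H x Mx).
Qed.

(** With all weights expressed through the lowest one, identities between densities become
    polynomial and within reach of [ring]. *)
Lemma powR_split mu x : 0 < x ->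
  [/\ x `^ (mu - 1) = x * x `^ (mu - 2), x `^ mu = x ^+ 2 * x `^ (mu - 2) &
      x `^ (mu + 1) = x ^+ 3 * x `^ (mu - 2)].
Proof.
move=> x0; have xn : x != 0 by rewrite gt_eqF.
have E n p : p = mu - 2 + n%:R -> x `^ p = x ^+ n * x `^ (mu - 2).
  by move=> ->; rewrite powRD ?xn ?implybT// powR_mulrn ?ltW// mulrC.
split; [rewrite (E 1)//|rewrite (E 2)//|rewrite (E 3)//]; ring.
Qed.

Lemma test_triple_square_integrable mu al be (psi p1 p2 : R -> R) :
  0 < mu -> test_triple psi p1 p2 ->
  integrable_hl (fun x =>
    (x * p2 x + (al + x) * p1 x + be * psi x) ^+ 2 * x `^ (mu - 1)).
Proof.
move=> mu0 [d0 d1 [p3 d2] [M H]].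
apply: (@integrable_powR_support _ _ _ M); [|by lra|].
- apply: continuous_sqr => x; have := d0 x; have := d1 x; have := d2 x => ? ? ?.
  by apply: has_deriv_continuous; repeat deriv_step.
- by move=> x /H[-> -> ->]; rewrite !mulr0 !addr0 expr0n.
Qed.

Lemma test_triple_square_identity mu al be (psi p1 p2 : R -> R) :
  0 < mu -> al = mu \/ 1 < mu -> test_triple psi p1 p2 ->
  integ (fun x => (x * p2 x + (al + x) * p1 x + be * psi x) ^+ 2 * x `^ (mu - 1))
  = integ (fun x => p2 x ^+ 2 * x `^ (mu + 1))
    + (al ^+ 2 - al * mu) * integ (fun x => p1 x ^+ 2 * x `^ (mu - 1))
    + integ (fun x => p1 x ^+ 2 * x `^ (mu + 1))
    + (be ^+ 2 - be * mu) * integ (fun x => psi x ^+ 2 * x `^ (mu - 1))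
    + (2 * al - mu - 1 - 2 * be) * integ (fun x => p1 x ^+ 2 * x `^ mu)
    + be * (mu - 1) * (mu - al) * integ (fun x => psi x ^+ 2 * x `^ (mu - 2)).
Proof.
move=> mu0 mual test.
have iS := test_triple_square_integrable al be mu0 test.
have I p : -1 < p -> _ := @test_triple_integrable _ _ _ p test.
have [_ i1b i2] := I (mu + 1) ltac:(lra).
have [i0 i1a _] := I (mu - 1) ltac:(lra).
have [_ i1c _] := I mu ltac:(lra).
set kap := be * (mu - 1) * (mu - al).
(* The exponent [mu - 2] exceeds [-1] only when [1 < mu]; otherwise [al = mu] makes the coefficient
   vanish. *)
have /integZ_degenerate[iM EM] : kap = 0 \/
    integrable_hl (fun x => psi x ^+ 2 * x `^ (mu - 2)).
  case: mual => [almu|mu1]; first by left; rewrite /kap almu subrr mulr0.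
  by right; have [] := I (mu - 2) ltac:(lra).
have [d0 d1 [p3 d2] [M H0]] := test.
set S := (S in integ S = _) in iS *.
pose T x := p2 x ^+ 2 * x `^ (mu + 1)
  + (al ^+ 2 - al * mu) * (p1 x ^+ 2 * x `^ (mu - 1))
  + p1 x ^+ 2 * x `^ (mu + 1)
  + (be ^+ 2 - be * mu) * (psi x ^+ 2 * x `^ (mu - 1))
  + (2 * al - mu - 1 - 2 * be) * (p1 x ^+ 2 * x `^ mu)
  + kap * (psi x ^+ 2 * x `^ (mu - 2)).
have iZ c h : integrable_hl h -> integrable_hl (fun x => c * h x) := @integrable_hlZ _ c h.
have iT : integrable_hl T.
  apply: integrable_hlD => //; apply: integrable_hlD; last exact: iZ.
  apply: integrable_hlD; last exact: iZ.
  apply: integrable_hlD; last exact: i1b.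
  by apply: integrable_hlD; [exact: i2|exact: iZ].
have ET : integ T = integ (fun x => p2 x ^+ 2 * x `^ (mu + 1))
    + (al ^+ 2 - al * mu) * integ (fun x => p1 x ^+ 2 * x `^ (mu - 1))
    + integ (fun x => p1 x ^+ 2 * x `^ (mu + 1))
    + (be ^+ 2 - be * mu) * integ (fun x => psi x ^+ 2 * x `^ (mu - 1))
    + (2 * al - mu - 1 - 2 * be) * integ (fun x => p1 x ^+ 2 * x `^ mu)
    + kap * integ (fun x => psi x ^+ 2 * x `^ (mu - 2)).
  rewrite -EM -!integZ//.
  have j1 := integrable_hlD i2 (iZ (al ^+ 2 - al * mu) _ i1a).
  have j2 := integrable_hlD j1 i1b.
  have j3 := integrable_hlD j2 (iZ (be ^+ 2 - be * mu) _ i0).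
  have j4 := integrable_hlD j3 (iZ (2 * al - mu - 1 - 2 * be) _ i1c).
  rewrite -(integD i2)//; last exact: iZ.
  rewrite -(integD j1)// -(integD j2)//; last exact: iZ.
  by rewrite -(integD j3) ?(integD j4)//; exact: iZ.
suff : integ (fun x => S x - T x) = 0.
  by rewrite integB// ET => /eqP; rewrite subr_eq0 => /eqP.
pose H x := (al + x) * p1 x ^+ 2 + 2 * be * (psi x * p1 x) + be * psi x ^+ 2.
(* Sorted by the behaviour at [0]: the part in [x^mu] vanishes there for all [mu > 0], the part in
   [x^(mu - 1)] because [1 < mu] or its coefficient is [0]. *)
pose B x := H x * x `^ mu + be * (al - mu) * (psi x ^+ 2 * x `^ (mu - 1)).
have cH : continuous H.
  by move=> x; have := d0 x; have := d1 x => ? ?; apply: has_deriv_continuous;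
    repeat deriv_step.
have Hsupp x : M < `|x| -> H x = 0.
  by move=> /H0[E0 E1 _]; rewrite /H E0 E1 !expr2 !mulr0 !addr0.
have [C C0 HC] := bounded_of_support cH Hsupp.
apply: (@integ0_of_primitive _ B).
- move=> x x0; have := d0 x; have := d1 x => ? ?.
  have [E1 E2 E3] := powR_split mu x0.
  have E4 : mu - 1 - 1 = mu - 2 by ring.
  deriv_tac; rewrite E4 /S /T /H /kap E3 E2 E1 /=; ring.
- move=> x x0; have := d0 x; have := d1 x; have := d2 x => ? ? ?.
  by apply: has_deriv_continuous; repeat deriv_step.
- exact: integrable_hlB.
- rewrite -[X in _ --> X](addr0 0); apply: cvgD.
    exact: (powR_bounded_cvg0 mu0 HC).
  case: mual => [->|mu1].
    rewrite subrr mulr0; under eq_cvg do rewrite mul0r; exact: cvg_cst.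
  rewrite -[X in _ --> X](mulr0 (be * (al - mu))).
  apply: cvgM; first exact: cvg_cst.
  have cp : continuous (fun x => psi x ^+ 2).
    by apply: continuous_sqr => x; exact: has_deriv_continuous (d0 x).
  have sp x : M < `|x| -> psi x ^+ 2 = 0 by move=> /H0[-> _ _]; rewrite expr0n.
  have [C' _ HC'] := bounded_of_support cp sp.
  by apply: (@powR_bounded_cvg0 _ (fun x => psi x ^+ 2) _ C') => //; rewrite subr_gt0.
- exists `|M| => x Mx; have Mx' : M < `|x|.
    by rewrite (le_lt_trans (ler_norm M))// (lt_le_trans Mx)// ler_norm.
  by rewrite /B Hsupp//; have [-> _ _] := H0 x Mx'; rewrite expr0n !mul0r mulr0 addr0.
Qed.

(** The derivative of [psi^2 x^(mu - 1)] has integral [0]; once it is added to the right-hand side,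
    the difference of the two sides is the integral of [(psi + p1)^2 x^(mu - 1)]. *)
Lemma test_triple_Hardy mu (psi p1 p2 : R -> R) : 1 < mu -> test_triple psi p1 p2 ->
  (mu - 1) * integ (fun x => psi x ^+ 2 * x `^ (mu - 2)) <=
  integ (fun x => p1 x ^+ 2 * x `^ (mu - 1)) +
  integ (fun x => psi x ^+ 2 * x `^ (mu - 1)).
Proof.
move=> mu1 test; have I p : -1 < p -> _ := @test_triple_integrable _ _ _ p test.
have [i0 i1 _] := I (mu - 1) ltac:(lra).
have [iM _ _] := I (mu - 2) ltac:(lra).
have [d0 d1 _ [M H0]] := test.
have c0 : continuous psi by move=> x; exact: has_deriv_continuous (d0 x).
have c1 : continuous p1 by move=> x; exact: has_deriv_continuous (d1 x).
pose b x := 2 * (psi x * p1 x * x `^ (mu - 1))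
  + (mu - 1) * (psi x ^+ 2 * x `^ (mu - 2)).
have ib : integrable_hl b.
  apply: integrable_hlD; apply: integrable_hlZ => //.
  apply: (@integrable_powR_support _ _ _ M); [|lra|].
  - by move=> x; apply: cvgM; [exact: c0|exact: c1].
  - by move=> x /H0[-> _ _]; rewrite mul0r.
have b0 : integ b = 0.
  apply: (@integ0_of_primitive _ (fun x => psi x ^+ 2 * x `^ (mu - 1))) => //.
  - move=> x x0; have := d0 x => ?; have E4 : mu - 1 - 1 = mu - 2 by ring.
    by deriv_tac; rewrite E4 /b; ring.
  - move=> x x0; have := d0 x; have := d1 x => ? ?.
    by apply: has_deriv_continuous; repeat deriv_step.
  - have cp := continuous_sqr c0.
    have sp x : M < `|x| -> psi x ^+ 2 = 0 by move=> /H0[-> _ _]; rewrite expr0n.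
    have [C _ HC] := bounded_of_support cp sp.
    by apply: (@powR_bounded_cvg0 _ (fun x => psi x ^+ 2) _ C) => //; rewrite subr_gt0.
  - exists `|M| => x Mx; have Mx' : M < `|x|.
      by rewrite (le_lt_trans (ler_norm M))// (lt_le_trans Mx)// ler_norm.
    by have [-> _ _] := H0 x Mx'; rewrite expr0n mul0r.
rewrite -integZ// -integD// -[leRHS]add0r -b0 -integD//; last exact: integrable_hlD.
apply: le_integ; [exact: integrable_hlZ|exact: integrable_hlD ib (integrable_hlD i1 i0)|].
move=> x x0; rewrite /b -subr_ge0.
rewrite (_ : _ - _ = (psi x + p1 x) ^+ 2 * x `^ (mu - 1)); last by ring.
by rewrite mulr_ge0 ?sqr_ge0 ?powR_ge0.
Qed.

End TestFunctions.

(** * Continuity of the regular terms *)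

Section LimitIdentity.
Local Open Scope classical_set_scope.
Variable R : realType.
Local Notation leb := (@lebesgue_measure R).
Local Notation hl := (@half_line R).
Implicit Types (f g h u v w : R -> R) (phi : nat -> R -> R) (x p mu al be C : R).

Definition sq_cvg g (gn : nat -> R -> R) w : Prop :=
  integrable_hl (fun x => g x ^+ 2 * w x) /\
  integ (fun x => gn n x ^+ 2 * w x) @[n --> \oo] -->
    integ (fun x => g x ^+ 2 * w x).

(** The norm of D_mu does not contain the weight [x^mu] of P_0; it is controlled by the two
    neighbouring weights of [f']. *)
Lemma powR_mid_le mu x : 0 < x -> x `^ mu <= x `^ (mu + 1) + x `^ (mu - 1).
Proof.
move=> x0; have [-> -> ->] := powR_split mu x0.
rewrite -mulrDl ler_wpM2r ?powR_ge0// -subr_ge0.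
rewrite (_ : _ - _ = x * ((x - 1) ^+ 2 + x)); last by ring.
by rewrite mulr_ge0 ?addr_ge0 ?sqr_ge0 ?ltW.
Qed.

Lemma approximates_sq_cvg mu phi phi1 phi2 u u1 u2 al be :
  0 < mu -> approximates mu phi phi1 phi2 u u1 u2 ->
  [/\ sq_cvg u2 phi2 (fun x => x `^ (mu + 1)),
      sq_cvg u1 phi1 (fun x => x `^ (mu + 1)),
      sq_cvg u1 phi1 (fun x => x `^ (mu - 1)),
      sq_cvg u phi (fun x => x `^ (mu - 1)) &
      sq_cvg u1 phi1 (fun x => x `^ mu) /\
      sq_cvg (fun x => x * u2 x + (al + x) * u1 x + be * u x)
        (fun n x => x * phi2 n x + (al + x) * phi1 n x + be * phi n x)
        (fun x => x `^ (mu - 1))].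
Proof.
move=> mu0 ap; have [m0 m1 m2 test _] := ap.
have I n p : -1 < p -> _ := @test_triple_integrable _ _ _ _ p (test n).
have mc0 n : measurable_fun hl (phi n).
  by have [c0 c1 c2] := test_triple_continuous (test n); exact: measurable_continuous_hl.
have mc1 n : measurable_fun hl (phi1 n).
  by have [c0 c1 c2] := test_triple_continuous (test n); exact: measurable_continuous_hl.
have mc2 n : measurable_fun hl (phi2 n).
  by have [c0 c1 c2] := test_triple_continuous (test n); exact: measurable_continuous_hl.
have ax : measurable_fun hl (fun x => al + x).
  apply: measurable_continuous_hl => x.
  by apply: cvgD; [exact: cvg_cst|exact: cvg_id].
have mx : measurable_fun hl (fun x : R => x).
  by apply: measurable_continuous_hl => x; exact: cvg_id.
have mlin g0 g1 g2 : measurable_fun hl g0 -> measurable_fun hl g1 ->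
    measurable_fun hl g2 ->
    measurable_fun hl (fun x => x * g2 x + (al + x) * g1 x + be * g0 x).
  move=> mg0 mg1 mg2; apply: measurable_funD; first apply: measurable_funD.
  - exact: measurable_funM.
  - exact: measurable_funM.
  - by apply: measurable_funM => //; exact: measurable_cst.
have pos n x : [/\ 0 <= (u2 x - phi2 n x) ^+ 2 * x `^ (mu + 1),
    0 <= (u1 x - phi1 n x) ^+ 2 * x `^ (mu + 1),
    0 <= (u1 x - phi1 n x) ^+ 2 * x `^ (mu - 1) &
    0 <= (u x - phi n x) ^+ 2 * x `^ (mu - 1)].
  by split; rewrite mulr_ge0 ?sqr_ge0 ?powR_ge0.
have K g (gn : nat -> R -> R) p C (mg : measurable_fun hl g)
    (mgn : forall n, measurable_fun hl (gn n)) (C0 : 0 <= C)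
    (ign : forall n, integrable_hl (fun x => gn n x ^+ 2 * x `^ p)) :=
  approximates_cvg ap mg mgn (@measurable_powR_hl R p)
    (fun x _ => powR_ge0 x p) C0 ign.
split.
- apply: (K _ _ _ 1) => // [n|n x x0].
    by have [] := I n (mu + 1) ltac:(lra).
  by have [a1 a2 a3 a4] := pos n x; lra.
- apply: (K _ _ _ 1) => // [n|n x x0].
    by have [] := I n (mu + 1) ltac:(lra).
  by have [a1 a2 a3 a4] := pos n x; lra.
- apply: (K _ _ _ 1) => // [n|n x x0].
    by have [] := I n (mu - 1) ltac:(lra).
  by have [a1 a2 a3 a4] := pos n x; lra.
- apply: (K _ _ _ 1) => // [n|n x x0].
    by have [] := I n (mu - 1) ltac:(lra).
  by have [a1 a2 a3 a4] := pos n x; lra.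
split.
  apply: (K _ _ _ 1) => // [n|n x x0].
    by have [] := I n mu ltac:(lra).
  have [a1 a2 a3 a4] := pos n x.
  have := ler_wpM2l (sqr_ge0 (u1 x - phi1 n x)) (powR_mid_le mu x0).
  by rewrite mulrDr; lra.
(* The square is split into the four terms [x r2], [x r1], [al r1] and [be r0]: Cauchy-Schwarz costs
   the factor [4], and [1 + al^2 + be^2] bounds each squared coefficient. *)
apply: (K _ _ _ (4 * (1 + al ^+ 2 + be ^+ 2))).
- exact: mlin.
- by move=> n; exact: mlin.
- by rewrite mulr_ge0// addr_ge0 ?sqr_ge0// addr_ge0 ?sqr_ge0.
- by move=> n; exact: test_triple_square_integrable.
move=> n x x0.
move: (u x) (u1 x) (u2 x) (phi n x) (phi1 n x) (phi2 n x) => v0 v1 v2 q0 q1 q2.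
have [-> E ->] := powR_split mu x0.
have Y0 : 0 <= x `^ (mu - 2) by exact: powR_ge0.
move: (x `^ (mu - 2)) Y0 => Y Y0.
set r2 := v2 - q2; set r1 := v1 - q1; set r0 := v0 - q0.
rewrite (_ : (_ - _) = x * r2 + (al + x) * r1 + be * r0); last first.
  by rewrite /r2 /r1 /r0; ring.
have -> : 4 * (1 + al ^+ 2 + be ^+ 2) * (r2 ^+ 2 * (x ^+ 3 * Y) +
    r1 ^+ 2 * (x ^+ 3 * Y) + r1 ^+ 2 * (x * Y) + r0 ^+ 2 * (x * Y)) =
  4 * (1 + al ^+ 2 + be ^+ 2) * ((x * r2) ^+ 2 + (x * r1) ^+ 2 + r1 ^+ 2 + r0 ^+ 2)
  * (x * Y) by ring.
rewrite ler_wpM2r ?mulr_ge0 ?(ltW x0)//.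
have S4 (a b c d : R) : (a + b + c + d) ^+ 2 <=
    4 * (a ^+ 2 + b ^+ 2 + c ^+ 2 + d ^+ 2).
  rewrite -subr_ge0 (_ : _ - _ = (a - b) ^+ 2 + (a - c) ^+ 2 + (a - d) ^+ 2
    + (b - c) ^+ 2 + (b - d) ^+ 2 + (c - d) ^+ 2); last by ring.
  by rewrite !addr_ge0 ?sqr_ge0.
rewrite (_ : x * r2 + _ + _ = x * r2 + al * r1 + x * r1 + be * r0); last by ring.
apply: (le_trans (S4 _ _ _ _)); rewrite -mulrA ler_pM2l// -subr_ge0.
rewrite (_ : _ - _ = (al ^+ 2 + be ^+ 2) * ((x * r2) ^+ 2 + (x * r1) ^+ 2)
   + (1 + be ^+ 2) * r1 ^+ 2 + (1 + al ^+ 2) * r0 ^+ 2); last by ring.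
have n1 (a b : R) : 0 <= a ^+ 2 + b ^+ 2 by rewrite addr_ge0 ?sqr_ge0.
have n2 (a : R) : 0 <= 1 + a ^+ 2 by rewrite addr_ge0 ?sqr_ge0.
apply: addr_ge0; [apply: addr_ge0|]; apply: mulr_ge0;
  [exact: n1|exact: n1|exact: n2|exact: sqr_ge0|exact: n2|exact: sqr_ge0].
Qed.

End LimitIdentity.

(** * Continuity of the term in x^(mu - 2) and passage to the limit *)

Section SingularTerm.
Local Open Scope classical_set_scope.
Variable R : realType.
Local Notation leb := (@lebesgue_measure R).
Local Notation hl := (@half_line R).
Implicit Types (f g h u v w : R -> R) (phi : nat -> R -> R) (x p mu al be C : R).

(* The weight [x^(mu - 2)] is truncated to [exh m], where it is dominated by
   [m.+1 x^(mu - 1)]; the bound passes to the limit, uniformly in [m]. *)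
Lemma approximates_Hardy mu phi phi1 phi2 u u1 u2 :
  1 < mu -> approximates mu phi phi1 phi2 u u1 u2 ->
  integrable_hl (fun x => u x ^+ 2 * x `^ (mu - 2)) /\
  (mu - 1) * integ (fun x => u x ^+ 2 * x `^ (mu - 2)) <=
  integ (fun x => u1 x ^+ 2 * x `^ (mu - 1)) +
  integ (fun x => u x ^+ 2 * x `^ (mu - 1)).
Proof.
move=> mu1 ap; have [m0 m1 m2 test _] := ap.
have mu0 : 0 < mu by lra.
have mu10 : 0 < mu - 1 by lra.
have [_ _ [iJ cJ] [iF cF] _] := approximates_sq_cvg 0 0 mu0 ap.
have I n p : -1 < p -> _ := @test_triple_integrable _ _ _ _ p (test n).
set RHS := (X in _ <= X).
suff [iM M_le] : integrable_hl (fun x => u x ^+ 2 * x `^ (mu - 2)) /\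
    integ (fun x => u x ^+ 2 * x `^ (mu - 2)) <= (mu - 1)^-1 * RHS.
  by split => //; rewrite -ler_pdivlMl.
apply: integrable_exhaustion.
- by move=> x x0; rewrite mulr_ge0 ?sqr_ge0 ?powR_ge0.
- move=> a b a0 ab.
  (* On [[a, b]] the density is the integrable one for [x^(mu - 1)] times the bounded function
     [1 / x]. *)
  have xV : measurable_fun `[a, b] (fun x : R => x^-1).
    apply: (@measurable_funS _ _ _ _ hl) => //; first exact: measurable_half_line.
      by move=> x; rewrite half_lineE /= in_itv/= => /andP[ax _]; lra.
    apply: continuous_hl_measurable => x x0.
    apply: (has_deriv_continuous (has_derivV _ (has_deriv_id x))).
    by rewrite gt_eqF.
  have H := integrable_hl_loc iF a0 ab.
  have xVa x : `[a, b]%classic x -> `|x^-1| <= a^-1.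
    rewrite /= in_itv/= => /andP[ax _]; have x0 : 0 < x by exact: lt_le_trans ax.
    by rewrite gtr0_norm ?invr_gt0// lef_pV2 ?posrE.
  have := integrable_bounded_mul (measurable_itv _) H xV xVa.
  apply: eq_integrable => // x /set_mem; rewrite /= in_itv/= => /andP[ax _].
  have x0 : 0 < x by exact: lt_le_trans ax.
  have [-> _ _] := powR_split mu x0; congr EFin; field.
  by rewrite gt_eqF.
move=> m; pose w := (fun x : R => x `^ (mu - 2)) \_ (exh m).
have w0 x : 0 <= w x by rewrite /w patchE; case: ifP => // _; exact: powR_ge0.
have wle x : w x <= x `^ (mu - 2).
  by rewrite /w patchE; case: ifP => // _; exact: powR_ge0.
have mw : measurable_fun hl w.
  have := @measurable_restrict _ _ _ _ (exh m) hl (fun x : R => x `^ (mu - 2))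
    (exh_measurable m) (@measurable_half_line R).
  by move=> <-; apply: measurable_funTS; exact: measurable_powR.
have wm x : 0 < x -> w x <= m.+1%:R * x `^ (mu - 1).
  move=> x0; rewrite /w patchE; case: ifPn => [/set_mem|_]; last first.
    by rewrite mulr_ge0 ?powR_ge0.
  rewrite /exh /= in_itv/= => /andP[mx _].
  have [-> _ _] := powR_split mu x0.
  rewrite mulrA ler_peMl ?powR_ge0//.
  by rewrite -ler_pdivrMl ?ltr0n// mulr1.
have mc n : measurable_fun hl (phi n).
  by have [c0 _ _] := test_triple_continuous (test n); exact: measurable_continuous_hl.
have iw n : integrable_hl (fun x => phi n x ^+ 2 * w x).
  have [iM _ _] := I n (mu - 2) ltac:(lra).
  apply: integrable_hl_le iM.
    by apply: measurable_funM => //; exact: measurable_funX.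
  move=> x x0; rewrite ger0_norm; last by apply: mulr_ge0; rewrite ?sqr_ge0.
  by rewrite ler_wpM2l ?sqr_ge0.
have [iu cu] : integrable_hl (fun x => u x ^+ 2 * w x) /\
    integ (fun x => phi n x ^+ 2 * w x) @[n --> \oo] -->
    integ (fun x => u x ^+ 2 * w x).
  apply: (approximates_cvg (C := m.+1%:R) ap) => //.
  move=> n x x0.
  have q1 : 0 <= (u2 x - phi2 n x) ^+ 2 * x `^ (mu + 1) by rewrite mulr_ge0 ?sqr_ge0 ?powR_ge0.
  have q2 : 0 <= (u1 x - phi1 n x) ^+ 2 * x `^ (mu + 1) by rewrite mulr_ge0 ?sqr_ge0 ?powR_ge0.
  have q3 : 0 <= (u1 x - phi1 n x) ^+ 2 * x `^ (mu - 1) by rewrite mulr_ge0 ?sqr_ge0 ?powR_ge0.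
  apply: (le_trans (ler_wpM2l (sqr_ge0 _) (wm x x0))).
  by rewrite mulrCA ler_wpM2l//; lra.
have -> : \int[leb]_(x in exh m) (u x ^+ 2 * x `^ (mu - 2)) =
    integ (fun x => u x ^+ 2 * w x).
  rewrite -(setIidr (@exh_sub R m)) Rintegral_mkcondr.
  apply: eq_Rintegral => x _; rewrite /w !patchE; case: ifP => // _.
  by rewrite mulr0.
have cR : (mu - 1)^-1 * (integ (fun x => phi1 n x ^+ 2 * x `^ (mu - 1)) +
    integ (fun x => phi n x ^+ 2 * x `^ (mu - 1))) @[n --> \oo] --> (mu - 1)^-1 * RHS.
  by apply: cvgM; [exact: cvg_cst|exact: cvgD].
apply: (ler_cvg_to cu cR); near=> n.
have [iM _ _] := I n (mu - 2) ltac:(lra).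
apply: (@le_trans _ _ (integ (fun x => phi n x ^+ 2 * x `^ (mu - 2)))).
  by apply: le_integ => // x x0; rewrite ler_wpM2l ?sqr_ge0.
by rewrite ler_pdivlMl//; exact: test_triple_Hardy (test n).
Unshelve. all: by end_near. Qed.

Lemma approximates_shift mu phi phi1 phi2 u u1 u2 n :
  approximates mu phi phi1 phi2 u u1 u2 ->
  approximates mu (fun k x => phi k x - phi n x) (fun k x => phi1 k x - phi1 n x)
    (fun k x => phi2 k x - phi2 n x) (fun x => u x - phi n x)
    (fun x => u1 x - phi1 n x) (fun x => u2 x - phi2 n x).
Proof.
move=> [m0 m1 m2 test c].
have [c0 c1 c2] := test_triple_continuous (test n).
split; try by apply: measurable_funB => //; exact: measurable_continuous_hl.
  by move=> k; exact: test_tripleB.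
rewrite (_ : (fun k => sqdistD _ _ _ _ _ _ _ k) = sqdistD mu phi phi1 phi2 u u1 u2)//.
apply/funext => k; rewrite /sqdistD.
by congr sqnormD; apply/funext => x; rewrite opprB addrA subrK.
Qed.

(** The Hardy inequality for [u] alone gives only a bound. Applied to [u - phi n], itself
    approximated by [phi k - phi n], it bounds the weighted distance by [(mu - 1)^-1] times the
    squared distance in D_mu. *)
Lemma approximates_singular_sq_cvg mu phi phi1 phi2 u u1 u2 :
  1 < mu -> approximates mu phi phi1 phi2 u u1 u2 ->
  sq_cvg u phi (fun x => x `^ (mu - 2)).
Proof.
move=> mu1 ap; have [m0 m1 m2 test c] := ap.
have mu0 : 0 < mu by lra.
have mu10 : 0 < mu - 1 by lra.
have mc n : [/\ measurable_fun hl (phi n), measurable_fun hl (phi1 n) &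
    measurable_fun hl (phi2 n)].
  have [c0 c1 c2] := test_triple_continuous (test n).
  by split; exact: measurable_continuous_hl.
apply: weighted_L2_cvg => //.
- by move=> n; have [] := mc n.
- exact: measurable_powR_hl.
- by move=> x _; exact: powR_ge0.
- by move=> n; have [] := test_triple_integrable (test n) (ltac:(lra) : -1 < mu - 2).
have cC : ((mu - 1)^-1%:E * sqdistD mu phi phi1 phi2 u u1 u2 n)%E @[n --> \oo] --> 0%E.
  by rewrite -(mule0 (mu - 1)^-1%:E); exact: cvgeZl.
apply: squeeze_cvge cC; last exact: cvg_cst.
near=> n; apply/andP; split.
  by apply: integral_ge0 => x _; rewrite lee_fin mulr_ge0 ?sqr_ge0 ?powR_ge0.
have ap' := approximates_shift n ap.
have [iM M_le] := approximates_Hardy mu1 ap'.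
have [_ _ [iJ _] [iF _] _] := approximates_sq_cvg 0 0 mu0 ap'.
rewrite integ_EFin//.
apply: (@le_trans _ _ ((mu - 1)^-1%:E * (integ (fun x => (u1 x - phi1 n x) ^+ 2 * x `^ (mu - 1)
   + (u x - phi n x) ^+ 2 * x `^ (mu - 1)))%:E)%E).
  by rewrite -EFinM lee_fin -ler_pdivrMl ?invr_gt0// invrK integD.
rewrite lee_wpmul2l//; first by rewrite lee_fin invr_ge0 ltW.
rewrite -integ_EFin; last exact: integrable_hlD.
rewrite -[leRHS]mul1e; have [mc0 mc1 mc2] := mc n.
apply: le_sqnormD => //; try exact: measurable_funB.
- by apply: measurable_funD; exact: integrable_hl_measurable.
- by move=> x _; apply: addr_ge0; apply: mulr_ge0; rewrite ?sqr_ge0 ?powR_ge0.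
move=> x _; rewrite mul1r -addrA lerDr.
by apply: addr_ge0; apply: mulr_ge0; rewrite ?sqr_ge0 ?powR_ge0.
Unshelve. all: by end_near. Qed.

Lemma approximates_square_identity mu al be phi phi1 phi2 u u1 u2 :
  0 < mu -> al = mu \/ 1 < mu -> approximates mu phi phi1 phi2 u u1 u2 ->
  integ (fun x => (x * u2 x + (al + x) * u1 x + be * u x) ^+ 2 * x `^ (mu - 1))
  = integ (fun x => u2 x ^+ 2 * x `^ (mu + 1))
    + (al ^+ 2 - al * mu) * integ (fun x => u1 x ^+ 2 * x `^ (mu - 1))
    + integ (fun x => u1 x ^+ 2 * x `^ (mu + 1))
    + (be ^+ 2 - be * mu) * integ (fun x => u x ^+ 2 * x `^ (mu - 1))
    + (2 * al - mu - 1 - 2 * be) * integ (fun x => u1 x ^+ 2 * x `^ mu)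
    + be * (mu - 1) * (mu - al) * integ (fun x => u x ^+ 2 * x `^ (mu - 2)).
Proof.
move=> mu0 mual ap; have [_ _ _ test _] := ap.
have [[_ cQ] [_ cX] [_ cJ] [_ cF] [[_ cP] [_ cS]]] := approximates_sq_cvg al be mu0 ap.
set kap := be * (mu - 1) * (mu - al).
have cM : kap * integ (fun x => phi n x ^+ 2 * x `^ (mu - 2)) @[n --> \oo] -->
    kap * integ (fun x => u x ^+ 2 * x `^ (mu - 2)).
  (* For [al = mu] the coefficient is [0] and nothing is claimed about the integrals. *)
  case: mual => [almu|mu1].
    rewrite /kap almu subrr mulr0 mul0r; under eq_cvg do rewrite mul0r.
    exact: cvg_cst.
  have [_ cM] := approximates_singular_sq_cvg mu1 ap.
  by apply: cvgM => //; exact: cvg_cst.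
have cZ c (a : nat -> R) l : a @ \oo --> l -> c * a n @[n --> \oo] --> c * l.
  by move=> al'; apply: cvgM => //; exact: cvg_cst.
have E := funext (fun n => test_triple_square_identity be mu0 mual (test n)).
rewrite E in cS; apply: (@cvg_unique _ (@Rhausdorff R) _ _ _ _ cS).
apply: cvgD; last exact: cM.
apply: cvgD; last exact: (cZ _ _ _ cP).
apply: cvgD; last exact: (cZ _ _ _ cF).
apply: cvgD; last exact: cX.
by apply: cvgD; [exact: cQ|exact: (cZ _ _ _ cJ)].
Qed.

End SingularTerm.

(** * Uniqueness for the Cauchy problem; divergence of 1/x at 0 *)

Section OrdinaryDifferentialEquation.
Local Open Scope classical_set_scope.
Variable R : realType.
Local Notation leb := (@lebesgue_measure R).
Local Notation hl := (@half_line R).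
Implicit Types (f g h F G V : R -> R) (x y a b c mu al be : R).

Lemma has_deriv_nincr V (V' : R -> R) a b : a <= b ->
  (forall x, a <= x <= b -> has_deriv V x (V' x)) ->
  (forall x, a <= x <= b -> V' x <= 0) -> V b <= V a.
Proof.
move=> ab dV V0; apply: (@ler0_derive1_nincr _ V a b) => //.
- by move=> x; rewrite in_itv/= => /andP[ax xb]; have [] := dV x ltac:(by rewrite !ltW).
- move=> x; rewrite in_itv/= => /andP[ax xb].
  have abx : a <= x <= b by rewrite !ltW.
  by rewrite derive1E; have [_ ->] := dV x abx; exact: V0.
- apply: continuous_in_subspaceT => x /set_mem; rewrite /= in_itv/= => abx.
  exact: has_deriv_continuous (dV x abx).
Qed.

Lemma has_deriv_ndecr V (V' : R -> R) a b : a <= b ->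
  (forall x, a <= x <= b -> has_deriv V x (V' x)) ->
  (forall x, a <= x <= b -> 0 <= V' x) -> V a <= V b.
Proof.
move=> ab dV V0; rewrite -lerN2.
apply: (@has_deriv_nincr (fun x => - V x) (fun x => - V' x)) => // x abx.
  by apply: has_derivN; exact: dV.
by rewrite oppr_le0; exact: V0.
Qed.

Lemma has_deriv0_const V : (forall x, 0 < x -> has_deriv V x 0) ->
  forall x y, 0 < x -> 0 < y -> V x = V y.
Proof.
move=> dV; have le x y : 0 < x -> x <= y -> V x = V y.
  move=> x0 xy; have dV' z : x <= z <= y -> has_deriv V z 0.
    by move=> /andP[xz _]; apply: dV; exact: lt_le_trans xz.
  apply/eqP; rewrite eq_le (has_deriv_ndecr xy dV')//=.
  exact: (has_deriv_nincr xy dV').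
move=> x y x0 y0; have [/le->//|/ltW /le ->//] := leP x y.
Qed.

(* The energy [v^2 + v'^2] satisfies a linear differential inequality on
   every [[m, oo)] with [m > 0]. *)
Lemma ode_zero al be x0 (v v1 v2 : R -> R) : 0 < al -> 0 < x0 ->
  (forall x, 0 < x -> has_deriv v x (v1 x)) ->
  (forall x, 0 < x -> has_deriv v1 x (v2 x)) ->
  (forall x, 0 < x -> x * v2 x + (al + x) * v1 x + be * v x = 0) ->
  v x0 = 0 -> v1 x0 = 0 -> forall x, 0 < x -> v x = 0.
Proof.
move=> al0 x00 dv dv1 ode vx0 v1x0 x x_gt0.
pose E y := v y ^+ 2 + v1 y ^+ 2.
have E0 y : 0 <= E y by rewrite addr_ge0 ?sqr_ge0.
have Ex0 : E x0 = 0 by rewrite /E vx0 v1x0 expr0n addr0.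
pose E' y := 2 * (v y * v1 y + v1 y * v2 y).
have dE y : 0 < y -> has_deriv E y (E' y).
  by move=> y0; have := dv y y0; have := dv1 y y0 => ? ?; deriv_tac; rewrite /E'; ring.
suff Ex : E x <= 0.
  have : v x ^+ 2 <= 0 by apply: le_trans Ex; rewrite lerDl sqr_ge0.
  by move=> vx; apply/eqP; rewrite -sqrf_eq0 eq_le vx sqr_ge0.
pose m := Num.min x x0.
have m0 : 0 < m by rewrite lt_min x_gt0.
(* Eliminating [v2] gives [E' = 2 v v1 (1 - be / y) - 2 (al / y + 1) v1^2]. For [y >= m] the parts
   of [K] bound the two coefficients, while [E] bounds [|2 v v1|] and [v1^2]. *)
pose K := 1 + `|be| / m + 2 * (al / m + 1).
have KE y : m <= y -> `|E' y| <= K * E y.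
  move=> my; have y0 : 0 < y by exact: lt_le_trans my.
  have yn : y != 0 by rewrite gt_eqF.
  have -> : E' y = 2 * (v y * v1 y) * (1 - be / y) - 2 * (al / y + 1) * v1 y ^+ 2.
    have V2 : v2 y = - ((al + y) * v1 y + be * v y) / y.
      by have o := ode y y0; apply: (mulfI yn); rewrite [RHS]mulrC divfK//; lra.
    by rewrite /E' V2; field.
  have iy : y^-1 <= m^-1 by rewrite lef_pV2 ?posrE.
  have iy0 : 0 <= y^-1 by rewrite invr_ge0 ltW.
  have vv1 : `|2 * (v y * v1 y)| <= E y.
    rewrite ler_norml /E -subr_ge0 -[X in _ && X]subr_ge0.
    rewrite (_ : _ - - _ = (v y + v1 y) ^+ 2); last by ring.
    by rewrite (_ : _ - _ = (v y - v1 y) ^+ 2) ?sqr_ge0//; ring.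
  have b1 : `|1 - be / y| <= 1 + `|be| / m.
    apply: (le_trans (ler_normB _ _)); rewrite normr1 lerD2l normrM.
    by rewrite (ger0_norm iy0) ler_wpM2l.
  have b2 : 0 <= 2 * (al / y + 1) <= 2 * (al / m + 1).
    apply/andP; split; first by rewrite mulr_ge0// addr_ge0// mulr_ge0// ltW.
    by rewrite ler_pM2l// lerD2r ler_pM2l.
  have v1E : v1 y ^+ 2 <= E y by rewrite /E lerDr sqr_ge0.
  apply: (le_trans (ler_normB _ _)); rewrite /K [leRHS]mulrDl; apply: lerD.
    by rewrite normrM mulrC ler_pM.
  case/andP: b2 => b20 b2; rewrite normrM (ger0_norm b20) (ger0_norm (sqr_ge0 _)).
  by rewrite ler_pM ?sqr_ge0.
have mx : m <= x by rewrite ge_min lexx.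
have mx0 : m <= x0 by rewrite ge_min lexx orbT.
(* Gronwall's argument in both directions: the factor is [exp(- K y)] to the right of [x0] and
   [exp(K y)] to its left. *)
have [x0x|xx0] := leP x0 x.
  pose Z y := E y * expR (- (K * y)).
  have : Z x <= Z x0.
    apply: (has_deriv_nincr (V' := fun y => (E' y - K * E y) * expR (- (K * y)))) => //.
      move=> y /andP[x0y _]; have := dE y (lt_le_trans x00 x0y) => ?.
      by deriv_tac; ring.
    move=> y /andP[x0y _]; rewrite mulr_le0_ge0 ?expR_ge0// subr_le0.
    by apply: le_trans (KE y (le_trans mx0 x0y)); exact: ler_norm.
  by rewrite /Z Ex0 mul0r pmulr_lle0// expR_gt0.
pose Z y := E y * expR (K * y).
have : Z x <= Z x0.
  apply: (has_deriv_ndecr (V' := fun y => (E' y + K * E y) * expR (K * y))) (ltW xx0) _ _.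
    move=> y /andP[xy _]; have := dE y (lt_le_trans x_gt0 xy) => ?.
    by deriv_tac; ring.
  move=> y /andP[xy _]; rewrite mulr_ge0 ?expR_ge0// -lerBlDr sub0r.
  by have := KE y (le_trans mx xy); rewrite ler_norml => /andP[].
by rewrite /Z Ex0 mul0r pmulr_lle0// expR_gt0.
Qed.

Lemma Rintegral_itv_le_integ h a b : integrable_hl h ->
  (forall x, 0 < x -> 0 <= h x) -> 0 < a ->
  \int[leb]_(x in `[a, b]) h x <= integ h.
Proof.
move=> hi h0 a0; have sub : `[a, b] `<=` hl.
  by move=> x; rewrite half_lineE /= in_itv/= => /andP[ax _]; lra.
have E : \int[leb]_(x in `[a, b]) h x = integ (h \_ `[a, b]).
  by rewrite /integ -Rintegral_mkcondr setIidr.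
rewrite E; apply: le_integ => //.
  apply: (@integrable_support _ hl `[a, b]) => //.
  - exact: measurable_half_line.
  - by move=> x _ xab; rewrite patchE memNset.
  have : leb.-integrable `[a, b] (EFin \o h).
    by apply: integrableS hi => //; exact: measurable_half_line.
  by apply: eq_integrable => // x xab; rewrite /= patchE xab.
by move=> x x0; rewrite patchE; case: ifP => // _; exact: h0.
Qed.

Lemma inv_not_integrable_at0 h c : 0 < c -> integrable_hl h ->
  (forall x, 0 < x -> 0 <= h x) ->
  ~ (forall x, 0 < x -> x <= 1 -> c / x <= h x).
Proof.
move=> c0 hi h0 ch; pose I := integ h.
have I0 : 0 <= I by exact: integ_ge0.
(* Chosen so that the integral of [c / x] over [[a, 1]] is exactly [I + 1]. *)
pose a := expR (- ((I + 1) / c)).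
have a0 : 0 < a by exact: expR_gt0.
have a1 : a < 1 by rewrite expR_lt1 oppr_lt0 divr_gt0// ltr_wpDl.
have [i1 E1] := @FTC_has_deriv _ (fun x => c * x^-1) (fun x => c * ln x) a 1 (ltW a1)
  (fun x ax => has_deriv_eq (has_derivM (has_deriv_cst c x)
     (is_derive1_ln (lt_le_trans a0 (andP ax).1))) (ltac:(by rewrite mul0r add0r)))
  (fun x ax => has_deriv_continuous (has_derivM (has_deriv_cst c x)
     (has_derivV (lt0r_neq0 (lt_le_trans a0 (andP ax).1)) (has_deriv_id x)))).
have : \int[leb]_(x in `[a, 1]) (c * x^-1) <= I.
  apply: le_trans (Rintegral_itv_le_integ 1 hi h0 a0).
  apply: le_Rintegral => //; first by exact: (integrable_hl_loc hi a0 a1).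
  by move=> x; rewrite /= in_itv/= => /andP[ax x1]; apply: ch => //; lra.
rewrite E1 ln1 mulr0 sub0r /a expRK mulrN opprK mulrC divfK ?gt_eqF//.
by apply/negP; rewrite -ltNge ltrDl.
Qed.

End OrdinaryDifferentialEquation.

(** * The equality case *)

Section EqualityCase.
Local Open Scope classical_set_scope.
Variable R : realType.
Local Notation leb := (@lebesgue_measure R).
Local Notation hl := (@half_line R).
Implicit Types (f g h F G V k : R -> R) (x y a b c mu al be : R).

Lemma continuous_bounded_01 k : continuous k ->
  exists2 K : R, 0 <= K & forall x, 0 < x -> x <= 1 -> `|k x| <= K.
Proof.
move=> ck; have c01 : {within `[0, 1], continuous (fun x => `|k x|)}.
  apply: continuous_subspaceT => x; apply: continuous_comp; first exact: ck.
  exact: norm_continuous.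
have [z _ zmax] := EVT_max ler01 c01.
by exists `|k z| => // x x0 x1; apply: zmax; rewrite in_itv/= ltW.
Qed.

(* The Wronskian with [kummer_sol] is [c x^-al e^-x]; since [mu <= 2 al], its
   square is not integrable at [0] for the weight [x^(mu - 1)] unless [c = 0]. *)
Lemma ode_weighted_L2 mu al be F G : 0 < al -> mu <= 2 * al ->
  (forall x, 0 < x -> has_deriv F x (G x)) ->
  (forall x, 0 < x -> has_deriv G x (- ((al + x) * G x + be * F x) / x)) ->
  integrable_hl (fun x => G x ^+ 2 * x `^ (mu - 1)) ->
  integrable_hl (fun x => F x ^+ 2 * x `^ (mu - 1)) ->
  exists C, forall x, 0 < x -> F x = C * kummer_sol al be x.
Proof.
move=> al0 mual dF dG iG iF.
pose k := kummer_sol al be; pose k1 := kummer_sol1 al be; pose k2 := kummer_sol2 al be.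
have dk x : has_deriv k x (k1 x) by exact: kummer_sol_has_deriv.
have dk1 x : has_deriv k1 x (k2 x) by exact: kummer_sol1_has_deriv.
have ok x : x * k2 x + (al + x) * k1 x + be * k x = 0 by exact: kummer_sol_ode.
have k0 : k 0 = 1 by exact: kummer_sol_at0.
have ck : continuous k by move=> x; exact: has_deriv_continuous (dk x).
have ck1 : continuous k1 by move=> x; exact: has_deriv_continuous (dk1 x).
(* From here on [k] is any solution regular at [0] with [k 0 = 1]. *)
rewrite -/k; move: k k1 k2 dk dk1 ok k0 ck ck1 => k k1 k2 dk dk1 ok k0 ck ck1.
pose W x := G x * k x - F x * k1 x.
(* Abel's formula: [x^al exp(x)] is the integrating factor for the first-order coefficient
   [(al + x) / x]. *)
pose V x := W x * x `^ al * expR x.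
have dV x : 0 < x -> has_deriv V x 0.
  move=> x0; have ? := dF x x0; have ? := dG x x0; have ? := dk x; have ? := dk1 x.
  have dE : has_deriv expR x (expR x) by exact: is_derive_expR.
  have xn : x != 0 by rewrite gt_eqF.
  deriv_tac.
  have xal : x `^ al = x * x `^ (al - 1) by rewrite mulr_powRB1// ltW.
  have := ok x => o.
  have k2E : k2 x = - ((al + x) * k1 x + be * k x) / x.
    by apply: (mulfI xn); rewrite [RHS]mulrC divfK//; lra.
  by rewrite xal /W k2E; field.
pose c := V 1.
have VE x : 0 < x -> V x = c by move=> x0; exact: has_deriv0_const.
have c0 : c = 0.
  apply: contrapT => /eqP cn.
  have [K K0 kK] := continuous_bounded_01 ck.
  have [K1 K10 kK1] := continuous_bounded_01 ck1.
  pose h x := 2 * (K ^+ 2 * (G x ^+ 2 * x `^ (mu - 1))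
    + K1 ^+ 2 * (F x ^+ 2 * x `^ (mu - 1))).
  have hi : integrable_hl h.
    by apply: integrable_hlZ; apply: integrable_hlD; exact: integrable_hlZ.
  have h0 x : 0 < x -> 0 <= h x.
    move=> x0; rewrite /h; apply: mulr_ge0 => //; apply: addr_ge0;
      (apply: mulr_ge0; [exact: sqr_ge0|]); apply: mulr_ge0;
      by [exact: sqr_ge0|exact: powR_ge0].
  (* On []0, 1]] the density [W^2 x^(mu - 1)] equals [c^2 exp(-2 x) x^(mu - 1 - 2 al)], which is at
     least [c^2 exp(-2) / x] because [mu <= 2 al]. *)
  have d0 : 0 < c ^+ 2 / expR 2 by rewrite divr_gt0 ?expR_gt0// exprn_even_gt0.
  apply: (inv_not_integrable_at0 d0 hi h0) => x x0 x1.
  have Wh : W x ^+ 2 * x `^ (mu - 1) <= h x.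
    have A1 : (G x * k x) ^+ 2 <= K ^+ 2 * G x ^+ 2.
      rewrite exprMn mulrC ler_wpM2r ?sqr_ge0// -[k x ^+ 2]real_normK ?num_real//.
      by rewrite lerXn2r ?nnegrE// kK.
    have A2 : (F x * k1 x) ^+ 2 <= K1 ^+ 2 * F x ^+ 2.
      rewrite exprMn mulrC ler_wpM2r ?sqr_ge0// -[k1 x ^+ 2]real_normK ?num_real//.
      by rewrite lerXn2r ?nnegrE// kK1.
    rewrite (_ : h x = 2 * (K ^+ 2 * G x ^+ 2 + K1 ^+ 2 * F x ^+ 2) * x `^ (mu - 1));
      last by rewrite /h; ring.
    rewrite ler_wpM2r ?powR_ge0//.
    apply: (@le_trans _ _ (2 * ((G x * k x) ^+ 2 + (F x * k1 x) ^+ 2))).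
      rewrite -subr_ge0 /W (_ : _ - _ = (G x * k x + F x * k1 x) ^+ 2) ?sqr_ge0//.
      by ring.
    by rewrite ler_pM2l// lerD.
  apply: le_trans Wh.
  have WV : W x * x `^ al * expR x = c by exact: VE.
  rewrite ler_pdivrMr// ler_pdivrMr ?expR_gt0// -WV.
  have -> : (W x * x `^ al * expR x) ^+ 2 = W x ^+ 2 * (x `^ al ^+ 2 * expR x ^+ 2).
    by ring.
  have -> : W x ^+ 2 * x `^ (mu - 1) * x * expR 2 =
      W x ^+ 2 * (x `^ (mu - 1) * x * expR 2) by ring.
  rewrite ler_wpM2l ?sqr_ge0// ler_pM ?sqr_ge0//; last first.
    by rewrite -expRM_natl ler_expR; lra.
  have -> : x `^ (mu - 1) * x = x `^ mu.
    have [-> -> _] := powR_split mu x0; ring.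
  have -> : x `^ al ^+ 2 = x `^ (2 * al).
    by rewrite -powR_mulrn ?powR_ge0// -powRrM mulrC.
  by apply: ger_powR => //; rewrite x0.
have W0 x : 0 < x -> G x * k x = F x * k1 x.
  move=> x0; have := VE x x0; rewrite c0 /V => /eqP.
  rewrite mulf_eq0 (gt_eqF (expR_gt0 x)) orbF mulf_eq0 (gt_eqF (powR_gt0 al x0)) orbF.
  by rewrite subr_eq0 => /eqP.
(* A point near [0] avoids the possible zeros of [k]. There [F / k] fixes [C], and the vanishing
   Wronskian makes the first derivatives match too. *)
have [x0 x00 kx0] : exists2 x0, 0 < x0 & k x0 != 0.
  have /cvgrPdist_lt/(_ 1 ltr01)[e /= e0 He] : {for 0, continuous k} by exact: ck.
  have e2 : 0 < e / 2 by lra.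
  exists (e / 2) => //; apply/negP => /eqP k_e2.
  have := He (e / 2); rewrite k_e2 k0 subr0 normr1 ltxx => H; apply/notF/H.
  by rewrite /= sub0r normrN gtr0_norm//; lra.
pose C := F x0 / k x0; exists C => x x_gt0; apply/eqP; rewrite -subr_eq0; apply/eqP.
apply: (@ode_zero _ al be x0 (fun x => F x - C * k x) (fun x => G x - C * k1 x)
  (fun x => - ((al + x) * G x + be * F x) / x - C * k2 x)) => //.
- move=> y y0; have ? := dF y y0; have ? := dk y.
  by deriv_tac; ring.
- move=> y y0; have ? := dG y y0; have ? := dk1 y.
  by deriv_tac; ring.
- move=> y y0; have o := ok y; have yn : y != 0 by rewrite gt_eqF.
  rewrite mulrBr [y * (_ / y)]mulrC divfK//.
  rewrite (_ : _ + _ = - C * (y * k2 y + (al + y) * k1 y + be * k y)); last by ring.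
  by rewrite o mulr0.
- by rewrite /C divfK// subrr.
- have := W0 x0 x00 => Wx0; rewrite /C; apply: (mulIf kx0).
  rewrite mul0r mulrBl Wx0 mulrAC divfK//; ring.
Qed.

Lemma integrable_hl_ae f g : integrable_hl f -> measurable_fun hl g ->
  ae_eq_half_line f g -> integrable_hl g.
Proof.
move=> fi mg fg; have mf := integrable_hl_measurable fi.
move/integrableP: fi => [_ fy]; apply/integrableP; split; first exact/measurable_EFinP.
rewrite (_ : \int[leb]_(x in hl) _ = \int[leb]_(x in hl) `|(EFin \o f) x|)%E//.
apply: ge0_ae_eq_integral => //.
- exact: measurable_half_line.
- by apply: measurableT_comp => //; exact/measurable_EFinP.
- by apply: measurableT_comp => //; exact/measurable_EFinP.
- by move: fg; apply: (@filterS _ _ (ae_filter_ringOfSetsType leb)) => x fg /fg /= ->.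
Qed.

Lemma ae_eq_half_lineP f g : ae_eq_half_line f g <->
  {ae leb, forall x, 0 < x -> f x = g x}.
Proof.
by split; apply: (@filterS _ _ (ae_filter_ringOfSetsType leb)) => x;
  rewrite half_lineE.
Qed.

Lemma integ_sq_eq0 g : integrable_hl g -> (forall x, 0 < x -> 0 <= g x) ->
  integ g = 0 <-> ae_eq_half_line g (fun=> 0).
Proof.
move=> gi g0; have mhl := @measurable_half_line R.
have mg : measurable_fun hl (EFin \o g).
  by apply/measurable_EFinP; exact: integrable_hl_measurable.
have [A1 A2] := @ae_eq_integral_abs _ _ _ leb hl mhl _ mg.
have E : (\int[leb]_(x in hl) `|(EFin \o g) x|)%E = (integ g)%:E.
  rewrite -integ_EFin//; apply: eq_integral => x /set_mem; rewrite half_lineE => x0.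
  by rewrite /= ger0_norm// g0.
rewrite E in A1 A2; split => [g_0|gae].
  have := A1 ltac:(by rewrite g_0).
  by apply: (@filterS _ _ (ae_filter_ringOfSetsType leb)) => x H /H [].
have : (integ g)%:E = 0%E.
  apply: A2; move: gae; apply: (@filterS _ _ (ae_filter_ringOfSetsType leb)).
  by move=> x H /H /= ->.
by case.
Qed.

(** The continuous representative of [f] coincides everywhere with [k], and its derivative is [g]
    almost everywhere. *)
Lemma wderiv_ae f g k (k1 : R -> R) : is_wderiv f g -> ae_eq_half_line f k ->
  (forall x, 0 < x -> has_deriv k x (k1 x)) -> ae_eq_half_line g k1.
Proof.
move=> fg fk dk; have [_ gi _] := fg.
have [F fF FP] := wderiv_primitive fg.
have Fk : forall x, 0 < x -> F x = k x.
  apply: ae_eq_hl_continuous.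
  - exact: primitive_continuous FP.
  - by move=> x x0; exact: has_deriv_continuous (dk x x0).
  - move: fF fk; apply: (@filterS2 _ _ (ae_filter_ringOfSetsType leb)) => x H1 H2 x0.
    by rewrite -H1// H2.
apply/ae_eq_half_lineP; have := primitive_ae_has_deriv gi FP.
apply: (@filterS _ _ (ae_filter_ringOfSetsType leb)) => x H x0.
apply: has_deriv_unique (H x0) _; apply: has_deriv_near (dk x x0).
by near=> y; rewrite Fk//; near: y; exact: lt_nbhsr.
Unshelve. all: by end_near. Qed.

Lemma in_D_is_wderiv mu f : in_D mu f ->
  is_wderiv f (wderiv f) /\ is_wderiv (wderiv f) (wderiv (wderiv f)).
Proof. by move=> [wf wf1 _]; split; exact: wderivP. Qed.

Lemma square_eq0_iff mu al be f : 0 < mu -> 0 < al -> mu <= 2 * al ->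
  in_D mu f ->
  let S x := (x * wderiv (wderiv f) x + (al + x) * wderiv f x + be * f x) ^+ 2
    * x `^ (mu - 1) in
  integ S = 0 <->
  exists C, ae_eq_half_line f (fun x => C * kummer_sol al be x).
Proof.
move=> mu0 al0 mual fD S; have [w1 w2] := in_D_is_wderiv fD.
have [phi [phi1 [phi2 ap]]] := in_D_approximates fD.
have [_ _ [iJ _] [iF _] [_ [iS _]]] := approximates_sq_cvg al be mu0 ap.
have SE := integ_sq_eq0 iS (fun x _ => mulr_ge0 (sqr_ge0 _) (powR_ge0 x _)).
rewrite SE; split => [S0|[C fC]].
  have [_ gi _] := w1; have [_ hi _] := w2.
  have [F fF FP] := wderiv_primitive w1.
  have [G gG GP] := wderiv_primitive w2.
  have cF := primitive_continuous gi FP.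
  have cG := primitive_continuous hi GP.
  (* Bootstrap: the continuity of [G] makes [F] differentiable. The equation solved for the second
     derivative then exhibits a continuous representative of the latter, which makes [G]
     differentiable in turn. *)
  have dF := primitive_has_deriv_continuous gi FP gG cG.
  have cH x : 0 < x -> {for x, continuous (fun x => - ((al + x) * G x + be * F x) / x)}.
    move=> x0; apply: cvgM; last first.
      by apply: cvgV; [rewrite gt_eqF|exact: cvg_id].
    apply: cvgN; apply: cvgD; apply: cvgM; [|exact: cG|exact: cvg_cst|exact: cF].
    by apply: cvgD; [exact: cvg_cst|exact: cvg_id].
  have hH : ae_eq_half_line (wderiv (wderiv f)) (fun x => - ((al + x) * G x + be * F x) / x).
    move: S0; apply: (@filterS3 _ _ (ae_filter_ringOfSetsType leb)) fF gG => x fF gG S0 hx.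
    have := S0 hx; rewrite /S -fF// -gG// => /eqP.
    have x0 : 0 < x by move: hx; rewrite half_lineE.
    have xn : x != 0 by rewrite gt_eqF.
    rewrite mulf_eq0 sqrf_eq0 (gt_eqF (powR_gt0 _ x0)) orbF => /eqP o.
    by apply: (mulfI xn); rewrite [RHS]mulrC divfK//; lra.
  have dG := primitive_has_deriv_continuous hi GP hH cH.
  have mp := @measurable_powR_hl R (mu - 1).
  have iG' : integrable_hl (fun x => G x ^+ 2 * x `^ (mu - 1)).
    apply: integrable_hl_ae iJ _ _.
      by apply: measurable_funM => //; apply: measurable_funX; exact: continuous_hl_measurable.
    by move: gG; apply: (@filterS _ _ (ae_filter_ringOfSetsType leb)) => x H /H ->.
  have iF' : integrable_hl (fun x => F x ^+ 2 * x `^ (mu - 1)).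
    apply: integrable_hl_ae iF _ _.
      by apply: measurable_funM => //; apply: measurable_funX; exact: continuous_hl_measurable.
    by move: fF; apply: (@filterS _ _ (ae_filter_ringOfSetsType leb)) => x H /H ->.
  have [C FC] := ode_weighted_L2 al0 mual dF dG iG' iF'.
  exists C; move: fF; apply: (@filterS _ _ (ae_filter_ringOfSetsType leb)) => x fF hx.
  by rewrite fF// FC//; move: hx; rewrite half_lineE.
have d1 x : 0 < x -> has_deriv (fun x => C * kummer_sol al be x) x (C * kummer_sol1 al be x).
  move=> x0; have ? := kummer_sol_has_deriv be x al0.
  apply: has_deriv_eq; first by apply: has_derivM; [exact: has_deriv_cst|eassumption].
  by rewrite mul0r add0r.
have d2 x : 0 < x -> has_deriv (fun x => C * kummer_sol1 al be x) x (C * kummer_sol2 al be x).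
  move=> x0; have ? := kummer_sol1_has_deriv be x al0.
  apply: has_deriv_eq; first by apply: has_derivM; [exact: has_deriv_cst|eassumption].
  by rewrite mul0r add0r.
have gC := wderiv_ae w1 fC d1; have hC := wderiv_ae w2 gC d2.
move: fC; apply: (@filterS3 _ _ (ae_filter_ringOfSetsType leb)) gC hC => x fC gC hC hx.
rewrite fC// gC// hC//.
rewrite (_ : _ + _ = C * (x * kummer_sol2 al be x + (al + x) * kummer_sol1 al be x
  + be * kummer_sol al be x)); last by ring.
by rewrite kummer_sol_ode// mulr0 expr0n mul0r.
Qed.

End EqualityCase.

(** * The identity in terms of the functionals *)

Section Densities.
Variable R : realType.
Implicit Types (f : R -> R) (mu al be eps x : R).

Lemma sqr_norm (a : R) : `|a| ^+ 2 = a ^+ 2.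
Proof. by rewrite real_normK ?num_real. Qed.

Lemma sqr_sqrt_disc mu eps : eps <= mu ^+ 2 / 4 ->
  Num.sqrt (mu ^+ 2 - 4 * eps) ^+ 2 = mu ^+ 2 - 4 * eps.
Proof. by move=> H; rewrite sqr_sqrtr//; lra. Qed.

(** The condition on [be] gives the integral of [f^2 x^(mu - 1)] the coefficient [- eps], so that it
    merges with the term in [x^(mu + 1)] into P_1. *)
Lemma in_D_identity mu al be eps f : 0 < mu -> al = mu \/ 1 < mu ->
  be ^+ 2 - be * mu = - eps -> in_D mu f ->
  [/\ [/\ integrable_hl (Q_dens mu f), integrable_hl (J_dens mu f),
          integrable_hl (P1_dens mu eps f), integrable_hl (P0_dens mu f) &
          integrable_hl (square_dens mu al be f)],
      1 < mu -> integrable_hl (Mminus_dens mu f) &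
      integ (square_dens mu al be f) =
        Q mu f + (al ^+ 2 - al * mu) * J mu f + P1 mu eps f
        + (2 * al - mu - 1 - 2 * be) * P0 mu f
        + be * (mu - 1) * (mu - al) * Mminus mu f].
Proof.
move=> mu0 mual bee fD; have [phi [phi1 [phi2 ap]]] := in_D_approximates fD.
have id := approximates_square_identity be mu0 mual ap.
have [[iQ _] [iX _] [iJ _] [iF _] [[iP _] [iS _]]] := approximates_sq_cvg al be mu0 ap.
have EQ : Q_dens mu f = fun x => wderiv (wderiv f) x ^+ 2 * x `^ (mu + 1).
  by apply/funext => x; rewrite /Q_dens sqr_norm.
have EJ : J_dens mu f = fun x => wderiv f x ^+ 2 * x `^ (mu - 1).
  by apply/funext => x; rewrite /J_dens sqr_norm.
have EP : P0_dens mu f = fun x => wderiv f x ^+ 2 * x `^ mu.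
  by apply/funext => x; rewrite /P0_dens sqr_norm.
have EM : Mminus_dens mu f = fun x => f x ^+ 2 * x `^ (mu - 2).
  by apply/funext => x; rewrite /Mminus_dens sqr_norm.
have ES : square_dens mu al be f = fun x =>
    (x * wderiv (wderiv f) x + (al + x) * wderiv f x + be * f x) ^+ 2 * x `^ (mu - 1).
  by apply/funext => x; rewrite /square_dens sqr_norm.
have EP1 x : 0 < x -> wderiv f x ^+ 2 * x `^ (mu + 1)
    - eps * (f x ^+ 2 * x `^ (mu - 1)) = P1_dens mu eps f x.
  move=> x0; rewrite /P1_dens !sqr_norm; have [-> _ ->] := powR_split mu x0; ring.
have iFe := integrable_hlZ eps iF.
have iP1 := integrable_hl_eq EP1 (integrable_hlB iX iFe).
split.
- by rewrite EQ EJ EP ES.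
- move=> mu1; rewrite EM; exact: (approximates_singular_sq_cvg mu1 ap).1.
rewrite ES id bee /Q EQ /J EJ /P0 EP /Mminus EM.
have EI : P1 mu eps f = integ (fun x => wderiv f x ^+ 2 * x `^ (mu + 1))
    - eps * integ (fun x => f x ^+ 2 * x `^ (mu - 1)).
  by rewrite -(integZ eps iF) -(integB iX iFe); apply/esym/eq_integ.
by rewrite EI mulNr !addrA.
Qed.

Lemma in_D_square_eq0 mu al be f : 0 < mu -> 0 < al -> mu <= 2 * al -> in_D mu f ->
  integ (square_dens mu al be f) = 0 <-> exists C : R, ae_eq_half_line f
    (fun x => C * (expR (- x) * kummer (al - be) al x)).
Proof.
move=> mu0 al0 mual fD; rewrite -(square_eq0_iff be mu0 al0 mual fD).
by rewrite /integ; under eq_Rintegral do rewrite /square_dens sqr_norm.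
Qed.

Lemma square_dens_ge0 mu al be f : 0 <= integ (square_dens mu al be f).
Proof. by apply: integ_ge0 => x _; rewrite mulr_ge0 ?sqr_ge0 ?powR_ge0. Qed.

End Densities.

(** * Specialization of [al] and [be], for [1 < mu] and for [eta = 0] *)

Theorem proposition2p3 (R : realType) :
  (forall mu eps eta : R,
    1 < mu -> 0 < eps -> eps < mu ^+ 2 / 4 -> 0 <= eta -> eta <= mu ^+ 2 / 4 ->
    let alpha := (mu + Num.sqrt (mu ^+ 2 - 4 * eta)) / 2 in
    let beta := (mu + Num.sqrt (mu ^+ 2 - 4 * eps)) / 2 in
    let K := 1 + mu + Num.sqrt (mu ^+ 2 - 4 * eps)
               - Num.sqrt (mu ^+ 2 - 4 * eta) in
    let L := (mu + Num.sqrt (mu ^+ 2 - 4 * eps)) / 2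
               * ((mu - Num.sqrt (mu ^+ 2 - 4 * eta)) / 2) * (mu - 1) in
    forall f : R -> R, in_D mu f ->
    [/\ (* all the integrals converge *)
        [/\ integrable_hl (Q_dens mu f), integrable_hl (J_dens mu f),
            integrable_hl (P1_dens mu eps f) &
            [/\ integrable_hl (P0_dens mu f), integrable_hl (Mminus_dens mu f) &
                integrable_hl (square_dens mu alpha beta f)]],
        (* the inequality *)
        Q mu f - eta * J mu f + P1 mu eps f >= K * P0 mu f - L * Mminus mu f,
        (* the equality case *)
        Q mu f - eta * J mu f + P1 mu eps f = K * P0 mu f - L * Mminus mu f
          <-> exists C : R, ae_eq_half_line f
                (fun x => C * (expR (- x) * kummer (alpha - beta) alpha x)) &
        (* the identity *)
        integ (square_dens mu alpha beta f)
          = Q mu f - eta * J mu f + P1 mu eps f - K * P0 mu f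
            + beta * (mu - 1) * (mu - alpha) * Mminus mu f])
  /\
  (forall mu eps : R,
    0 < mu -> 0 < eps -> eps < mu ^+ 2 / 4 ->
    let alpha0 := (mu + Num.sqrt (mu ^+ 2 - 4 * 0)) / 2 in
    let beta := (mu + Num.sqrt (mu ^+ 2 - 4 * eps)) / 2 in
    let b := (mu - Num.sqrt (mu ^+ 2 - 4 * eps)) / 2 in
    let f0 := fun x : R => expR (- x) * kummer b mu x in
    [/\ alpha0 = mu,
        beta = mu - b &
        forall f : R -> R, in_D mu f ->
        [/\ [/\ integrable_hl (Q_dens mu f), integrable_hl (P1_dens mu eps f),
                integrable_hl (P0_dens mu f) &
                integrable_hl (square_dens mu mu (mu - b) f)],
            beta * (mu - 1) * (mu - alpha0) * Mminus mu f = 0,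
            Q mu f + P1 mu eps f
              - (1 + Num.sqrt (mu ^+ 2 - 4 * eps)) * P0 mu f
              = integ (fun x : R =>
                  `|x * wderiv (wderiv f) x + (x + mu) * wderiv f x
                    + (mu - b) * f x| ^+ 2 * x `^ (mu - 1)),
            Q mu f + P1 mu eps f
              >= (1 + Num.sqrt (mu ^+ 2 - 4 * eps)) * P0 mu f &
            Q mu f + P1 mu eps f
              = (1 + Num.sqrt (mu ^+ 2 - 4 * eps)) * P0 mu f
              <-> exists C : R, ae_eq_half_line f (fun x => C * f0 x)]]).
Proof.
split=> [mu eps eta mu1 eps0 epsmu eta0 etamu alpha beta K L f fD|
    mu eps mu0 eps0 epsmu].
  have mu0 : 0 < mu by apply: lt_trans mu1.
  have := sqr_sqrt_disc (ltW epsmu); have := sqr_sqrt_disc etamu.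
  have := sqrtr_ge0 (mu ^+ 2 - 4 * eta).
  (* The square roots become variables known only by their squares and, for [t], by its sign: the
     rest is polynomial algebra. *)
  move: @alpha @beta @K @L; move: (Num.sqrt _) (Num.sqrt _) => s t.
  move=> alpha beta K L t0 t2 s2.
  have al0 : 0 < alpha by rewrite divr_gt0// ltr_wpDr.
  (* Here the choice of the larger root matters: [2 alpha = mu + t] with [t >= 0]. *)
  have mual : mu <= 2 * alpha by rewrite mulrC divfK ?pnatr_eq0// lerDl.
  have bee : beta ^+ 2 - beta * mu = - eps.
    rewrite (_ : _ - _ = (s ^+ 2 - mu ^+ 2) / 4); last by rewrite /beta; field.
    by rewrite s2; field.
  have ale : alpha ^+ 2 - alpha * mu = - eta.
    rewrite (_ : _ - _ = (t ^+ 2 - mu ^+ 2) / 4); last by rewrite /alpha; field.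
    by rewrite t2; field.
  have [[iQ iJ iP1 iP0 iS] iM id] :=
    in_D_identity mu0 (or_intror mu1 : alpha = mu \/ _) bee fD.
  have KE : 2 * alpha - mu - 1 - 2 * beta = - K by rewrite /alpha /beta /K; field.
  have LE : beta * (mu - 1) * (mu - alpha) = L by rewrite /alpha /beta /L; field.
  have idK : integ (square_dens mu alpha beta f) =
      Q mu f - eta * J mu f + P1 mu eps f - (K * P0 mu f - L * Mminus mu f).
    by rewrite id ale KE LE !mulNr opprB addrA addrAC.
  split.
  - by split=> //; split=> //; exact: iM.
  - by rewrite -subr_ge0 -idK; exact: square_dens_ge0.
  - rewrite -(in_D_square_eq0 beta mu0 al0 mual fD) idK.
    by split=> [->|/eqP]; [rewrite subrr|rewrite subr_eq0 => /eqP].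
  - by rewrite idK LE opprB addrA addrAC.
have mu_sqrt : Num.sqrt (mu ^+ 2 - 4 * 0) = mu.
  by rewrite mulr0 subr0 sqrtr_sqr gtr0_norm.
have := sqr_sqrt_disc (ltW epsmu); rewrite mu_sqrt.
move: (Num.sqrt _) => s s2 alpha0 beta b f0.
have alpha0E : alpha0 = mu by rewrite /alpha0; field.
have betaE : beta = mu - b by rewrite /beta /b; field.
split=> // f fD.
have bee : beta ^+ 2 - beta * mu = - eps.
  rewrite (_ : _ - _ = (s ^+ 2 - mu ^+ 2) / 4); last by rewrite /beta; field.
  by rewrite s2; field.
(* The branch [al = mu] of the alternative, available for every [mu > 0]. *)
have [[iQ iJ iP1 iP0 iS] _ id] :=
  in_D_identity mu0 (or_introl (erefl mu) : _ \/ 1 < mu) bee fD.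
have KE : 2 * mu - mu - 1 - 2 * beta = - (1 + s) by rewrite /beta; field.
have idK : integ (square_dens mu mu beta f) =
    Q mu f + P1 mu eps f - (1 + s) * P0 mu f.
  (* With [al = mu], both [al^2 - al mu] and [mu - al] vanish, which removes J and M_-. *)
  by rewrite id KE -expr2 !subrr mulr0 !mul0r !addr0 mulNr.
have mual : mu <= 2 * mu by rewrite mulrC mulrDr mulr1 lerDl ltW.
split.
- by rewrite -betaE.
- by rewrite alpha0E subrr mulr0 mul0r.
- rewrite -idK -betaE; congr integ; apply/funext => x.
  by rewrite /square_dens (addrC mu).
- by rewrite -subr_ge0 -idK; exact: square_dens_ge0.
have E : (fun C => ae_eq_half_line f (fun x => C * f0 x)) = fun C => ae_eq_half_line f
    (fun x => C * (expR (- x) * kummer (mu - beta) mu x)).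
  by apply/funext => C; rewrite /f0 betaE opprB addrC subrK.
rewrite E -(in_D_square_eq0 beta mu0 mu0 mual fD) idK.
by split=> [->|/eqP]; [rewrite subrr|rewrite subr_eq0 => /eqP].
Qed.
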